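(* $\dim\sigma_5(\mathbf{P}^2\times\mathbf{P}^3\times\mathbf{P}^3)=43$.
   Context: Work over a field of characteristic zero (not necessarily algebraically closed). $\mathbf{P}^2\times\mathbf{P}^3\times\mathbf{P}^3$ denotes the Segre variety embedded in $\mathbf{P}(V_1\otimes V_2\otimes V_3)=\mathbf{P}^{47}$, where $\dim V_1=3$, $\dim V_2=\dim V_3=4$. The $s$-secant variety $\sigma_s(X)$ of $X\subseteq\mathbf{P}^m$ is the Zariski closure of the union of the linear spans of $s$-tuples of points of $X$; $\dim$ is the projective dimension. *)

(* Defs.v *)
From HB Require Import structures.
From mathcomp Require Import all_boot all_order all_algebra.
From mathcomp Require Import ring_quotient.
From mathcomp Require Import mpoly.

Set Implicit Arguments.
Unset Strict Implicit.
Unset Printing Implicit Defensive.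

Import GRing.Theory.
Local Open Scope ring_scope.

(* P(V) is the set of lines of V; subsets of P(V) are Prop-valued predicates. *)
Definition proj_space (K : fieldType) (V : vectType K) :=
  {L : {vspace V} | \dim L == 1%N}.

(* K^m (x) K^n is identified with K^(m * n) by u (x) v |-> (u_i * v_j)_(i, j). *)
Definition tens (K : fieldType) (m n : nat) (u : 'rV[K]_m) (v : 'rV[K]_n)
  : 'rV[K]_(m * n) := mxvec (u^T *m v).

(* The Segre variety P^a x P^b x P^c in P(K^(a+1) (x) K^(b+1) (x) K^(c+1)). *)
Definition segre (K : fieldType) (a b c : nat)
    (P : proj_space 'rV[K]_(a.+1 * (b.+1 * c.+1))) : Prop :=
  exists (u : 'rV[K]_a.+1) (v : 'rV[K]_b.+1) (w : 'rV[K]_c.+1),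
    [/\ u != 0, v != 0, w != 0 & val P = <[tens u (tens v w)]>%VS].

Definition lin_span (K : fieldType) (V : vectType K) (s : nat)
    (P : 'I_s -> proj_space V) (Q : proj_space V) : Prop :=
  (val Q <= \sum_(i < s) val (P i))%VS.

Definition secant_union (K : fieldType) (V : vectType K) (s : nat)
    (X : proj_space V -> Prop) (Q : proj_space V) : Prop :=
  exists2 P : 'I_s -> proj_space V, forall i, X (P i) & lin_span P Q.

Definition homogeneous (K : fieldType) (n : nat) (f : {mpoly K[n]}) : Prop :=
  exists d : nat, f \is d.-homog.

(* Meaningful for homogeneous f, for which it says that f is 0 at any nonzero
   vector of the line Q. *)
Definition vanishes_at (K : fieldType) (n : nat) (f : {mpoly K[n]})
    (Q : proj_space 'rV[K]_n) : Prop :=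
  forall v : 'rV[K]_n, v \in val Q -> f.@[fun i => v ord0 i] = 0.

Definition zariski_closed (K : fieldType) (n : nat)
    (Z : proj_space 'rV[K]_n -> Prop) : Prop :=
  exists2 F : {mpoly K[n]} -> Prop,
    forall f, F f -> homogeneous f &
    forall Q, Z Q <-> (forall f, F f -> vanishes_at f Q).

Definition zariski_closure (K : fieldType) (n : nat)
    (S : proj_space 'rV[K]_n -> Prop) (Q : proj_space 'rV[K]_n) : Prop :=
  forall Z, zariski_closed Z -> (forall P, S P -> Z P) -> Z Q.

Definition secant_variety (K : fieldType) (n s : nat)
    (X : proj_space 'rV[K]_n -> Prop) : proj_space 'rV[K]_n -> Prop :=
  zariski_closure (secant_union s X).

(* The points of the scheme P^(n-1) = Proj K[x_1, ..., x_n]: the homogeneous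
   prime ideals that do not contain all the variables. *)
Record proj_prime (K : fieldType) (n : nat) (p : {pred {mpoly K[n]}}) : Prop :=
  ProjPrime {
    proj_prime_ideal : idealr_closed p;
    proj_prime_prime : prime_idealr_closed p;
    proj_prime_homog : forall f d, f \in p -> pihomog mdeg d f \in p;
    proj_prime_relevant : exists i : 'I_n, 'X_i \notin p
  }.

(* p contains the homogeneous ideal I(Z) of Z. *)
Definition contains_ideal_of (K : fieldType) (n : nat)
    (Z : proj_space 'rV[K]_n -> Prop) (p : {pred {mpoly K[n]}}) : Prop :=
  forall f, homogeneous f -> (forall Q, Z Q -> vanishes_at f Q) -> f \in p.

(* A chain p_0 < ... < p_r of irreducible closed subsets of the projective
   variety Proj K[x_1, ..., x_n] / I(Z), given by their generic points. *)
Definition proj_chain (K : fieldType) (n : nat)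
    (Z : proj_space 'rV[K]_n -> Prop) (r : nat)
    (p : nat -> {pred {mpoly K[n]}}) : Prop :=
  [/\ forall i, (i <= r)%N -> proj_prime (p i),
      contains_ideal_of Z (p 0%N) &
      forall i, (i < r)%N ->
        {subset p i <= p i.+1} /\ exists2 f, f \in p i.+1 & f \notin p i].

(* The (Krull) dimension of the projective variety Z is d. It is computed on
   Proj K[x_1, ..., x_n] / I(Z) rather than on the topological space of the
   K-points of Z, whose dimension may be too small when K is not algebraically
   closed. *)
Definition proj_dim (K : fieldType) (n : nat)
    (Z : proj_space 'rV[K]_n -> Prop) (d : nat) : Prop :=
  (exists p, proj_chain Z d p) /\
  (forall r p, proj_chain Z r p -> (r <= d)%N).

(* Main.v *)
Require Import Defs.
From mathcomp Require Import all_boot all_order all_algebra.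
From mathcomp Require Import ring_quotient.
From mathcomp Require Import mpoly.
From mathcomp Require Import ring zify.

Set Implicit Arguments.
Unset Strict Implicit.
Unset Printing Implicit Defensive.

Import GRing.Theory.
Local Open Scope ring_scope.

(** The dimension is one less than the count of parameters predicts, because of a
    rational curve.  Through five general points of P^2 x P^3 x P^3 there is
    one rational curve of tridegree (2, 3, 3): the conic through the five points
    of P^2 fixes the five parameter values, and for given parameter values there
    is one twisted cubic through five general points of P^3.  The curve has
    degree 8 and spans a P^8, in which a general point lies on a one-parameter
    family of 4-planes spanned by five points of the curve.  So the
    44-dimensional parameter space of pairs (five points, point of their span)
    maps onto the secant variety with fibres of dimension at least one.

    Upper bound.  Write the points of these P^8 as [curve_tensor A B C h], where
    the rows of [A], [B], [C] are the coefficients of the curve and [h] is a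
    linear functional on polynomials of degree at most 8.  These tensors depend
    on 50 parameters and include a dense subset of the cone over the secant variety
    ([general_position_curve], [vanishes_on_secants_dense]).  Their entries are
    killed by six vector fields: sl_2 acting on the parameter of the curve, and the
    rescalings of [A], [B], [C] that [h] compensates.  A chain of primes p_0 < ... < p_r, continued by
    the irrelevant ideal, gives r + 1 polynomials that are algebraically
    independent modulo p_0 ([prime_chain_indep]).  Their values on the 50-parameter
    family are killed by the six fields, hence remain independent when six
    coordinates transversal to the fields are added ([derivation_indep]).  As n
    variables carry at most n independent polynomials ([alg_dependent]),
    r + 1 + 6 <= 50.

    Lower bound.  At one explicit five-tuple, the tensor and its derivatives along
    43 coordinate directions are linearly independent ([slot_directions_free]).
    Opening these directions one at a time gives 44 parametrized cones inside the
    affine cone of the secant variety.  Their ideals are homogeneous primes.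
    Those of two consecutive cones, with i + 1 and i + 2 parameters, differ because
    some i + 2 linear forms are independent on the bigger cone, by its Jacobian, and
    dependent on the smaller one, for lack of parameters ([family_ideal_proper]). *)

(** * Evaluation of multivariate polynomials *)

Lemma rmorph_mmap (K : nzRingType) (S S' : comNzRingType) n (f : {rmorphism K -> S})
    (h : 'I_n -> S) (phi : {rmorphism S -> S'}) (G : {mpoly K[n]}) :
  phi (mmap f h G) = mmap (phi \o f) (phi \o h) G.
Proof.
rewrite /mmap rmorph_sum; apply: eq_bigr => m _; rewrite rmorphM rmorph_prod.
by congr (_ * _); apply: eq_bigr => i _; rewrite rmorphXn.
Qed.

Lemma eq_mmap (K S : nzRingType) n (f f' : K -> S) (h h' : 'I_n -> S) (G : {mpoly K[n]}) :
  f =1 f' -> h =1 h' -> mmap f h G = mmap f' h' G.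
Proof.
move=> ef eh; apply: eq_bigr => m _; rewrite ef; congr (_ * _).
exact: mmap1_eq.
Qed.

Lemma mmap_id (K : comNzRingType) n (G : {mpoly K[n]}) :
  mmap (@mpolyC n K) (fun i => 'X_i) G = G.
Proof.
rewrite [RHS]mpolyE; apply: eq_bigr => m _.
by rewrite mmap1_id mul_mpolyC.
Qed.

(** Separating the last variable; this makes induction on the number of
    variables possible below. *)
Lemma mmap_muni (K S : comNzRingType) n (f : {rmorphism K -> S})
    (h : 'I_n.+1 -> S) (G : {mpoly K[n.+1]}) :
  mmap f h G =
    (map_poly (mmap f (fun i => h (widen_ord (leqnSn n) i))) (muni G)).[h ord_max].
Proof.
rewrite muniE rmorph_sum horner_sum; apply: eq_bigr => m _.
rewrite /= map_polyZ map_polyXn hornerZ hornerXn /= mmapZ mmapX -mulrA; congr (_ * _).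
rewrite {1}/mmap1 big_ord_recr /=; congr (_ * _).
by apply: eq_bigr => i _; rewrite mnmE.
Qed.

Lemma muni_eq0 (K : comNzRingType) n (G : {mpoly K[n.+1]}) : muni G = 0 -> G = 0.
Proof. by rewrite -{2}[G]mmap_id mmap_muni => ->; rewrite map_poly0 horner0. Qed.

Lemma natr_inj_pchar0 (K : fieldType) : [pchar K] =i pred0 -> injective (fun n => n%:R : K).
Proof.
move=> /pcharf0P char0.
have le_inj (m n : nat) : (m <= n)%N -> m%:R = n%:R :> K -> m = n.
  move=> le_mn /eqP; rewrite eq_sym -subr_eq0 -natrB // char0 subn_eq0 => le_nm.
  by apply/eqP; rewrite eqn_leq le_mn.
by move=> m n; case/orP: (leq_total m n) => /le_inj le /= eq_mn; [|symmetry]; apply: le.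
Qed.

Lemma poly_vanish (K : fieldType) (p : {poly K}) : [pchar K] =i pred0 ->
  (forall x, p.[x] = 0) -> p = 0.
Proof.
move=> char0 p_eq0; apply/eqP; apply/negPn/negP => p_neq0.
pose s := [seq n%:R : K | n <- iota 0 (size p)].
have: (size s < size p)%N.
  apply: max_poly_roots => //; first by apply/allP => x _; rewrite /root p_eq0.
  by rewrite map_inj_uniq ?iota_uniq //; apply: natr_inj_pchar0.
by rewrite size_map size_iota ltnn.
Qed.

Lemma mpoly_nullary (K : nzRingType) (f : {mpoly K[0]}) : f = (f@_0)%:MP.
Proof.
apply/msize1_polyC; rewrite msizeE; apply/bigmax_leqP_seq => m _ _.
by rewrite mdegE big_ord0.
Qed.

(** Allows identities between polynomials to be checked on points with
    coordinates in [K], which is infinite. *)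
Lemma mpoly_vanish (K : fieldType) n (f : {mpoly K[n]}) : [pchar K] =i pred0 ->
  (forall x, f.@[x] = 0) -> f = 0.
Proof.
move=> char0; elim: n f => [|n IHn] f f_eq0.
  by have := f_eq0 (fun _ => 0); rewrite [f]mpoly_nullary mevalC => ->; rewrite mpolyC0.
apply: muni_eq0; apply/polyP => k; rewrite coef0; apply: IHn => x.
have /polyP/(_ k) : map_poly (meval x) (muni f) = 0.
  apply: poly_vanish => // y.
  pose xy (i : 'I_n.+1) := oapp x y (unlift ord_max i).
  rewrite -(f_eq0 xy) /meval mmap_muni /xy unlift_none /=; congr _.[_].
  apply: eq_map_poly => g; apply: eq_mmap => // i.
  have -> : widen_ord (leqnSn n) i = lift ord_max i.
    by apply: val_inj; rewrite /= /bump leqNgt ltn_ord.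
  by rewrite liftK.
by rewrite coef_map coef0.
Qed.

(** * Algebraic independence from chains of primes and from derivations *)

(** If G(g_0, ..., g_m) lies in q_(m+1), write G = Q X + c with X the last
    variable.  As g_m lies in q_m, so does c(g_0, ..., g_(m-1)), and c = 0 by
    induction on m.  Then Q g_m lies in the prime q_(m+1), which omits g_m, and one
    concludes by induction on the degree in X.  The chain is indexed downwards so
    that the variable split off is the last one. *)
Lemma prime_chain_indep (K : fieldType) n (q : nat -> {pred {mpoly K[n]}})
    (g : nat -> {mpoly K[n]}) m :
  (forall i, (i <= m)%N -> idealr_closed (q i) /\ prime_idealr_closed (q i)) ->
  (forall i, (i < m)%N -> {subset q i.+1 <= q i}) ->
  (forall i, (i < m)%N -> g i \in q i /\ g i \notin q i.+1) ->
  forall G : {mpoly K[m]}, mmap (@mpolyC n K) (g \o val) G \in q m -> G = 0.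
Proof.
elim: m => [|m IHm] q_prime q_sub g_in G.
  rewrite [G]mpoly_nullary mmapC => c_in; have [[_ q1 qM] _] := q_prime 0%N isT.
  apply/eqP; rewrite mpolyC_eq0; apply: contraNT q1 => c_neq0.
  have := qM ((G@_0)^-1)%:MP _ 0 c_in.
  have [q0 _ _] := (q_prime 0%N isT).1.
  by rewrite addr0 -mpolyCM mulVf //; apply.
have [[q0 q1 qM] q_pr] := q_prime m.+1 (leqnn _).
have [g_m g_mS] := g_in m (ltnSn m).
move=> G_in; apply: muni_eq0; move: G_in; rewrite mmap_muni.
set e := mmap _ _; move: (muni G) => P.
have IH c : e c \in q m -> c = 0.
  apply: IHm => i lt_im; [exact/q_prime/leqW|exact/q_sub/leqW|exact/g_in/leqW].
elim/poly_ind: P => [//|P c IHP].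
rewrite rmorphD rmorphM /= map_polyX map_polyC hornerMXaddC /= => in_q.
have ec_in : e c \in q m.
  have gm_in := q_sub m (ltnSn m) _ in_q.
  have [_ _ qM'] := (q_prime m (leqnSn _)).1.
  have := qM' (- (map_poly e P).[(g \o val) (@ord_max m)]) _ _ g_m gm_in.
  by rewrite mulNr addrA addNr add0r.
have c0 := IH c ec_in.
move: in_q; rewrite c0 [X in _ + X](raddf0 e) addr0 => /q_pr.
by rewrite /= (negPf g_mS) orbF => /IHP ->; rewrite mul0r polyC0 addr0.
Qed.

Lemma mpoly_ring_ind (K : comNzRingType) n (P : {mpoly K[n]} -> Prop) :
  (forall c, P c%:MP) -> (forall i, P 'X_i) ->
  (forall p q, P p -> P q -> P (p + q)) -> (forall p q, P p -> P q -> P (p * q)) ->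
  forall p, P p.
Proof.
move=> PC PX PD PM p; rewrite [p]mpolyE.
apply: big_ind => [||m _]; [by rewrite -mpolyC0 | exact: PD |].
rewrite -mul_mpolyC mpolyXE_id; apply: (PM) => //.
apply: big_ind => [||i _]; [exact: (PC 1) | exact: PM |].
by elim: (m i) => [|k IHk]; [exact: (PC 1) | rewrite exprS; apply: (PM)].
Qed.

Lemma msize_mderiv_lt (K : fieldType) n (G : {mpoly K[n]}) i :
  G != 0 -> (msize G^`M(i) < msize G)%N.
Proof.
move=> G_neq0; have: (0 < msize G)%N by rewrite lt0n msize_poly_eq0.
case eG: (msize G) => [//|s] _; rewrite ltnS msizeE.
apply/bigmax_leqP_seq => m m_in _; rewrite -ltnS -eG.
have /msize_mdeg_lt : (m + U_(i))%MM \in msupp G.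
  rewrite mcoeff_msupp; apply: contraTneq m_in => G_m.
  by rewrite mcoeff_msupp mcoeff_mderiv G_m mul0rn eqxx.
by rewrite mdegD mdeg1 addn1.
Qed.

Lemma mderivXU (K : comNzRingType) n (i j : 'I_n) :
  ('X_i : {mpoly K[n]})^`M(j) = (i == j)%:R.
Proof.
rewrite mderivX mnm1E; case: eqP => [->|_]; last by rewrite scale0r.
by rewrite scale1r -{1}[U_(j)%MM]add0m addmK mpolyX0.
Qed.

Definition alg_indep (K : fieldType) n m (g : 'I_m -> {mpoly K[n]}) :=
  forall G : {mpoly K[m]}, mmap (@mpolyC n K) g G = 0 -> G = 0.

Definition derivation (K : fieldType) n (c : 'I_n -> {mpoly K[n]}) (p : {mpoly K[n]}) :=
  \sum_(i < n) c i * p^`M(i).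

Lemma derivationC (K : fieldType) n (c : 'I_n -> {mpoly K[n]}) a :
  derivation c a%:MP = 0.
Proof. by rewrite /derivation big1 // => i _; rewrite mderivC mulr0. Qed.

Lemma derivationD (K : fieldType) n (c : 'I_n -> {mpoly K[n]}) p q :
  derivation c (p + q) = derivation c p + derivation c q.
Proof. by rewrite -big_split; apply: eq_bigr => i _; rewrite mderivD mulrDr. Qed.

Lemma derivationM (K : fieldType) n (c : 'I_n -> {mpoly K[n]}) p q :
  derivation c (p * q) = derivation c p * q + p * derivation c q.
Proof.
rewrite mulr_suml mulr_sumr -big_split; apply: eq_bigr => i _ /=.
by rewrite mderivM; ring.
Qed.

Lemma derivationX (K : fieldType) n (c : 'I_n -> {mpoly K[n]}) i :
  derivation c 'X_i = c i.
Proof.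
rewrite /derivation (bigD1 i) //= big1 ?addr0 => [|j neq_ji].
  by rewrite mderivXU eqxx mulr1.
by rewrite mderivXU eq_sym (negPf neq_ji) mulr0.
Qed.

Lemma derivation_mmap (K : fieldType) n m (c : 'I_n -> {mpoly K[n]})
    (g : 'I_m -> {mpoly K[n]}) (G : {mpoly K[m]}) :
  derivation c (mmap (@mpolyC n K) g G) =
    \sum_(j < m) mmap (@mpolyC n K) g G^`M(j) * derivation c (g j).
Proof.
elim/mpoly_ring_ind: G => [a|i|p q Dp Dq|p q Dp Dq].
- rewrite mmapC derivationC big1 // => j _.
  by rewrite mderivC mmap0 mul0r.
- rewrite mmapX mmap1U (bigD1 i) //= big1 ?addr0 => [|j neq_ji]; last first.
    by rewrite mderivXU eq_sym (negPf neq_ji) mmap0 mul0r.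
  by rewrite mderivXU eqxx rmorph1 mul1r.
- rewrite rmorphD derivationD Dp Dq -big_split; apply: eq_bigr => j _ /=.
  by rewrite mderivD mmapD mulrDl.
rewrite rmorphM derivationM /= Dp Dq mulr_suml mulr_sumr -big_split.
by apply: eq_bigr => j _ /=; rewrite mderivM mmapD !rmorphM; ring.
Qed.

(** In characteristic zero an exponent e > 0 survives differentiation as the factor e. *)
Lemma mderiv_const (K : fieldType) m k (G : {mpoly K[m + k]}) :
  [pchar K] =i pred0 -> (forall j, G^`M(rshift m j) = 0) ->
  exists G0 : {mpoly K[m]}, G = mmap (@mpolyC _ K) (fun i => 'X_(lshift k i)) G0.
Proof.
move=> /pcharf0P char0 dG.
exists (mmap (@mpolyC _ K) (fun i => if split i is inl l then 'X_l else 0) G).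
rewrite rmorph_mmap -[LHS]mmap_id; apply: eq_big_seq => mm mm_in.
rewrite /= mmapC; congr (_ * _); apply: eq_bigr => i _.
rewrite /=; case: split_ordP => [l ->|j ei]; first by rewrite mmapX mmap1U.
suff -> : mm i = 0%N by [].
apply/eqP; apply: contraTT mm_in => mm_i; rewrite -mcoeff_eq0.
have /(congr1 (mcoeff (mm - U_(i))%MM)) := dG j.
rewrite -ei mcoeff_mderiv mcoeff0 submK; last by rewrite lep1mP.
by move/eqP; rewrite -mulr_natr mulf_eq0 char0 orbF.
Qed.

(** Differentiating a relation G(g, z) = 0 along [c i] kills the [g l] and leaves
    a linear system for the values of the partial derivatives of G in the [z j],
    whose matrix is invertible because it is diagonal and invertible at [x].  So
    these partial derivatives are relations of smaller degree, hence zero by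
    induction, and G is a relation between the [g l] alone. *)
Lemma derivation_indep (K : fieldType) n m k (c : 'I_k -> 'I_n -> {mpoly K[n]})
    (g : 'I_m -> {mpoly K[n]}) (z : 'I_k -> {mpoly K[n]})
    (x : 'I_n -> K) (d : 'I_k -> K) :
  [pchar K] =i pred0 ->
  alg_indep g ->
  (forall i l, derivation (c i) (g l) = 0) ->
  (forall i j, (derivation (c i) (z j)).@[x] = d i *+ (i == j)) ->
  (forall i, d i != 0) ->
  alg_indep (fun i => match split i with inl l => g l | inr j => z j end).
Proof.
move=> char0 g_indep Dg Dz d_neq0 G.
set gz := fun i => _; have gzl l : gz (lshift k l) = g l.
  by rewrite /gz; case: split_ordP => j => [/lshift_inj -> //|/eqP]; rewrite eq_lrshift.
have gzr j : gz (rshift m j) = z j.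
  by rewrite /gz; case: split_ordP => l => [/eqP|/rshift_inj -> //]; rewrite eq_rlshift.
have [s] := ubnP (msize G); elim: s G => // s IHs G ltGs G_eq0.
have dG j : mmap (@mpolyC n K) gz G^`M(rshift m j) = 0.
  pose M := \matrix_(i, j) derivation (c i) (z j).
  have M_inj : \det M != 0.
    apply/eqP => /(congr1 (meval x)); rewrite meval0 -det_map_mx.
    have -> : map_mx (meval x) M = diag_mx (\row_i d i).
      by apply/matrixP => i l; rewrite !mxE Dz.
    by rewrite det_diag; apply/eqP/prodf_neq0 => i _; rewrite mxE.
  pose w := \col_j mmap (@mpolyC n K) gz G^`M(rshift m j).
  have Mw : M *m w = 0.
    apply/matrixP => i l; rewrite !mxE.
    have := derivation_mmap (c i) gz G.
    rewrite G_eq0 {1}/derivation big1 => [|a _]; last by rewrite mderiv0 mulr0.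
    rewrite big_split_ord /= big1 ?add0r => [/esym sum0|a _]; last by rewrite gzl Dg mulr0.
    by rewrite -[RHS]sum0; apply: eq_bigr => a _; rewrite !mxE gzr mulrC.
  have : \det M *: w = 0 by rewrite -mul_scalar_mx -mul_adj_mx -mulmxA Mw mulmx0.
  by move/matrixP/(_ j 0); rewrite !mxE => /eqP; rewrite mulf_eq0 (negPf M_inj) => /eqP.
have {}dG j : G^`M(rshift m j) = 0.
  have [-> |G_neq0] := eqVneq G 0; first exact: mderiv0.
  apply: IHs => //; exact: leq_trans (msize_mderiv_lt _ G_neq0) ltGs.
have [G0 eG] := mderiv_const char0 dG.
rewrite eG in G_eq0 *; rewrite (g_indep G0) ?mmap0 //.
rewrite -[RHS]G_eq0 rmorph_mmap; apply: eq_mmap => i /=; first by rewrite mmapC.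
by rewrite mmapX mmap1U gzl.
Qed.

(** * Dependence of more polynomials than variables *)

Lemma msizeM_leS (K : fieldType) n (p q : {mpoly K[n]}) a b :
  (msize p <= a.+1)%N -> (msize q <= b.+1)%N -> (msize (p * q) <= (a + b).+1)%N.
Proof.
have [->|p_neq0] := eqVneq p 0; first by rewrite mul0r msize0.
have [->|q_neq0] := eqVneq q 0; first by rewrite mulr0 msize0.
move=> le_pa le_qb; rewrite msizeM //.
have := leq_add le_pa le_qb; rewrite addSn addnS.
by case: (_ + _)%N => [//|s]; rewrite ltnS.
Qed.

Lemma msize_mmap1_le (K : fieldType) n m (g : 'I_m -> {mpoly K[n]}) d N (a : 'X_{1..m}) :
  (forall i, msize (g i) <= d.+1)%N -> (forall i, a i <= N)%N ->
  (msize (mmap1 g a) <= (m * (N * d)).+1)%N.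
Proof.
move=> le_gd le_aN; rewrite /mmap1 -[m in (m * _)%N]card_ord -sum_nat_const.
apply: (big_ind2 (fun p b => (msize p <= b.+1)%N)) => [|p b q c|i _].
- by rewrite msize1.
- exact: msizeM_leS.
have: (msize (g i ^+ a i) <= (a i * d).+1)%N.
  by elim: (a i) => [|k IHk]; [rewrite msize1 | rewrite exprS mulSn msizeM_leS].
by move/leq_trans; apply; rewrite ltnS leq_mul2r le_aN orbT.
Qed.

(** The N^m monomials in [g] with exponents below N are polynomials whose
    exponents are at most linear in N, so they live in a space of dimension
    O(N^n). *)
Lemma alg_dependent (K : fieldType) n m (g : 'I_m -> {mpoly K[n]}) : (n < m)%N ->
  exists2 G : {mpoly K[m]}, G != 0 & mmap (@mpolyC n K) g G = 0.
Proof.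
move=> lt_nm; pose d := (\max_i msize (g i))%N.
have le_gd i : (msize (g i) <= d.+1)%N by apply/leqW/leq_bigmax.
pose C := (m * d).+1; pose N := (C ^ n).+1; pose B := (m * (N * d)).+1.
have lt_BN : (B ^ n < N ^ m)%N.
  have le_BCN : (B <= C * N)%N.
    by rewrite /B /C [(_.+1 * N)%N]mulSn -mulnA [(d * N)%N]mulnC -add1n leq_add2r.
  have le_pow : (B ^ n <= (C * N) ^ n)%N.
    by case: (n) => // k; rewrite leq_exp2r.
  apply: leq_ltn_trans le_pow _.
  apply: leq_trans (leq_pexp2l _ lt_nm) => //.
  by rewrite expnMn expnS ltn_pmul2r ?expn_gt0 ?ltnSn.
pose row_mon (r : {ffun 'I_m -> 'I_N}) := [multinom r i : nat | i < m].
pose col_mon (c : {ffun 'I_n -> 'I_B}) := [multinom c i : nat | i < n].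
pose M := \matrix_(r < #|{ffun 'I_m -> 'I_N}|, c < #|{ffun 'I_n -> 'I_B}|)
  (mmap1 g (row_mon (enum_val r)))@_(col_mon (enum_val c)).
(* There are more rows, N ^ m, than columns, B ^ n. *)
have kerM : kermx M != 0.
  rewrite -mxrank_eq0 mxrank_ker -lt0n subn_gt0.
  apply: leq_ltn_trans (rank_leq_col M) _.
  by rewrite !card_ffun !card_ord.
have [v v_ker v_neq0] : exists2 v : 'rV_(_), v *m M = 0 & v != 0.
  have /rowV0Pn [v /sub_kermxP vM v_neq0] := kerM; by exists v.
pose G := \sum_r v 0 r *: 'X_[row_mon (enum_val r)].
exists G.
  apply: contra_neq v_neq0 => G_eq0; apply/rowP => r; rewrite mxE.
  have := congr1 (mcoeff (row_mon (enum_val r))) G_eq0.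
  rewrite mcoeff0 raddf_sum (bigD1 r) //= big1 ?addr0 => [|s neq_sr].
    by rewrite mcoeffZ mcoeffX eqxx mulr1.
  rewrite mcoeffZ mcoeffX; case: eqP => [/mnmP eq_sr|]; last by rewrite mulr0.
  case/eqP: neq_sr; apply/enum_val_inj/ffunP => i; apply/val_inj.
  by have := eq_sr i; rewrite !mnmE.
rewrite raddf_sum; apply/mpolyP => a; rewrite mcoeff0 raddf_sum /=.
under eq_bigr do rewrite mmapZ mmapX mcoeffCM.
have [lt_mB|] := boolP [forall i, a i < B]%N.
  pose c : {ffun 'I_n -> 'I_B} := [ffun i => Ordinal (forallP lt_mB i)].
  have ea : col_mon c = a by apply/mnmP => i; rewrite mnmE ffunE.
  have /rowP/(_ (enum_rank c)) := v_ker; rewrite !mxE => sum0.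
  by rewrite -[RHS]sum0; apply: eq_bigr => r _; rewrite mxE enum_rankK ea.
rewrite negb_forall => /existsP [i]; rewrite -leqNgt => le_Ba.
apply: big1 => r _; suff /eqP -> : (mmap1 g (row_mon (enum_val r)))@_a == 0 by rewrite mulr0.
rewrite mcoeff_eq0; apply: contraL le_Ba => /msize_mdeg_lt lt_a; rewrite -ltnNge.
have le_ia : (a i <= mdeg a)%N by rewrite mdegE (bigD1 i) //= leq_addr.
apply: leq_ltn_trans le_ia (leq_trans lt_a _).
apply: msize_mmap1_le => // j; rewrite mnmE; exact/ltnW/ltn_ord.
Qed.

(** * Length of chains of homogeneous primes *)

Definition irrelevant_ideal (K : fieldType) n : {pred {mpoly K[n]}} :=
  fun f => f@_0 == 0.

Lemma irrelevant_prime (K : fieldType) n :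
  idealr_closed (@irrelevant_ideal K n) /\ prime_idealr_closed (@irrelevant_ideal K n).
Proof.
rewrite /irrelevant_ideal; split=> [|u v]; last first.
  by rewrite !unfold_in /= rmorphM mulf_eq0.
split=> [||a u v]; rewrite !unfold_in /=.
- by rewrite mcoeff0.
- by rewrite mcoeff1 eqxx oner_eq0.
by rewrite mcoeffD rmorphM /= => /eqP -> /eqP ->; rewrite mulr0 addr0.
Qed.

Lemma mcoeff_pihomog (K : fieldType) n d (f : {mpoly K[n]}) m :
  (pihomog mdeg d f)@_m = f@_m *+ (mdeg m == d).
Proof.
rewrite pihomogE raddf_sum big_mkcond [in RHS](mpolyE f) raddf_sum -sumrMnl /=.
apply: eq_bigr => m' _; rewrite mcoeffZ mcoeffX.
case: (eqVneq m' m) => [->|neq_mm'].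
  by case: ifP => _; rewrite ?mcoeffZ ?mcoeffX ?eqxx.
by rewrite mulr0 mul0rn; case: ifP => _; rewrite // mcoeffZ mcoeffX (negPf neq_mm') mulr0.
Qed.

(** The constant term of a member of [p] is its component of degree 0, hence
    lies in [p], and [p] contains no unit. *)
Lemma proj_prime_irrelevant (K : fieldType) n (p : {pred {mpoly K[n]}}) :
  proj_prime p -> {subset p <= @irrelevant_ideal K n}.
Proof.
case=> [[p0 p1 pM] _ p_homog _] f f_in; rewrite unfold_in.
apply: contraNT p1 => f0; have := p_homog f 0%N f_in.
have -> : pihomog mdeg 0 f = (f@_0)%:MP.
  have /dhomogP homog0 := pihomogP [measure of mdeg] 0 f.
  have -> : f@_0 = (pihomog mdeg 0 f)@_0 by rewrite mcoeff_pihomog mdeg0.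
  apply/msize1_polyC; rewrite msizeE; apply/bigmax_leqP_seq => m m_in _.
  by rewrite (homog0 m m_in).
move=> f0_in; have := pM ((f@_0)^-1)%:MP _ 0 f0_in p0.
by rewrite addr0 -mpolyCM mulVf.
Qed.

(** [psi] is a parametrization by [N] variables with [k] independent directions
    along which it does not vary; these account for the [k] on the left, and the
    irrelevant ideal at the top of the chain for the successor of [r]. *)
Lemma proj_chain_bound (K : fieldType) n N k (psi : 'I_n -> {mpoly K[N]})
    (c : 'I_k -> 'I_N -> {mpoly K[N]}) (z : 'I_k -> {mpoly K[N]})
    (x : 'I_N -> K) (d : 'I_k -> K) Z r (p : nat -> {pred {mpoly K[n]}}) :
  [pchar K] =i pred0 ->
  (forall i l, derivation (c i) (psi l) = 0) ->
  (forall i j, (derivation (c i) (z j)).@[x] = d i *+ (i == j)) ->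
  (forall i, d i != 0) ->
  proj_chain Z r p ->
  (forall f, mmap (@mpolyC N K) psi f = 0 -> f \in p 0%N) ->
  (r.+1 + k <= N)%N.
Proof.
move=> char0 Dpsi Dz d_neq0 [p_prime _ p_sub] psi_p.
have step i : (i < r)%N -> exists f, (f \in p i.+1) && (f \notin p i).
  by move=> /p_sub [_ [f f_in f_notin]]; exists f; rewrite f_in.
pose f i := if insub i is Some (exist i' lt_ir) then xchoose (step i' lt_ir) else 0.
have f_in i : (i < r)%N -> f i \in p i.+1 /\ f i \notin p i.
  by rewrite /f => lt_ir; rewrite insubT; apply/andP/(xchooseP (step i lt_ir)).
have [x0 x0_notin] := proj_prime_relevant (p_prime r (leqnn r)).
(* The chain read from the top, starting with the irrelevant ideal. *)
pose q i := if i is j.+1 then p (r - j)%N else @irrelevant_ideal K n.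
pose g i := if i is j.+1 then f (r - j.+1)%N else 'X_x0.
have rj j : (j < r)%N -> (r - j = (r - j.+1).+1)%N by move=> lt_jr; rewrite -subSn.
have q_prime i : (i <= r.+1)%N -> idealr_closed (q i) /\ prime_idealr_closed (q i).
  case: i => [|i] le_ir; first exact: irrelevant_prime.
  by have [] := p_prime (r - i)%N (leq_subr _ _).
have q_sub i : (i < r.+1)%N -> {subset q i.+1 <= q i}.
  case: i => [|i]; first by rewrite /= subn0 => _; apply/proj_prime_irrelevant/p_prime.
  rewrite ltnS => lt_ir /=; rewrite (rj i) //; apply: (p_sub _ _).1.
  by rewrite -rj ?leq_subr.
have g_in i : (i < r.+1)%N -> g i \in q i /\ g i \notin q i.+1.
  case: i => [|i]; first by rewrite /= subn0 unfold_in mcoeffX mnm1_eq0 eqxx.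
  by rewrite ltnS => lt_ir /=; rewrite (rj i) //; apply: f_in; rewrite -rj ?leq_subr.
have g_indep := prime_chain_indep q_prime q_sub g_in.
rewrite leqNgt; apply/negP => lt_N.
pose F (l : 'I_r.+1) := mmap (@mpolyC N K) psi (g l).
have F_indep : alg_indep F.
  move=> G G_eq0; apply: g_indep; rewrite /= subnn; apply: psi_p.
  by rewrite rmorph_mmap -[RHS]G_eq0; apply: eq_mmap => // a; rewrite /= mmapC.
have DF i l : derivation (c i) (F l) = 0.
  by rewrite derivation_mmap big1 // => j _; rewrite Dpsi mulr0.
have indep := derivation_indep char0 F_indep DF Dz d_neq0.
pose Fz i := match split i with inl l => F l | inr j => z j end.
by have [G /eqP G_neq0 /indep] := alg_dependent Fz lt_N.
Qed.

(** * Sums of rank-one tensors and the cone over the secant variety *)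

(** The tensor product of three vectors, as in [tens], but over any ring: it is
    also used over polynomial rings. *)
Definition rank1 (R : comNzRingType) a b c (u : 'rV[R]_a) (v : 'rV[R]_b) (w : 'rV[R]_c) :
  'rV[R]_(a * (b * c)) := mxvec (u^T *m mxvec (v^T *m w)).

Definition tidx a b c (i : 'I_a) (j : 'I_b) (k : 'I_c) : 'I_(a * (b * c)) :=
  mxvec_index i (mxvec_index j k).

Lemma tidxP a b c (x : 'I_(a * (b * c))) : exists i j k, x = tidx i j k :> 'I_(a * (b * c)).
Proof. by case/mxvec_indexP: x => i y; case/mxvec_indexP: y => j k; exists i, j, k. Qed.

Lemma rank1E (R : comNzRingType) a b c (u : 'rV[R]_a) (v : 'rV[R]_b) (w : 'rV[R]_c) i j k :
  rank1 u v w 0 (tidx i j k) = u 0 i * v 0 j * w 0 k.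
Proof. by rewrite /rank1 /tidx mxvecE mxE big_ord1 mxE mxvecE mxE big_ord1 mxE mulrA. Qed.

Definition tsum (R : comNzRingType) s a b c
    (U : 'M[R]_(s, a)) (V : 'M[R]_(s, b)) (W : 'M[R]_(s, c)) :=
  \sum_(p < s) rank1 (row p U) (row p V) (row p W).

Lemma tsumE (R : comNzRingType) s a b c
    (U : 'M[R]_(s, a)) (V : 'M[R]_(s, b)) (W : 'M[R]_(s, c)) i j k :
  tsum U V W 0 (tidx i j k) = \sum_(p < s) U p i * V p j * W p k.
Proof. by rewrite summxE; apply: eq_bigr => p _; rewrite rank1E !mxE. Qed.

Lemma eq_tensor (R : Type) a b c (S T : 'rV[R]_(a * (b * c))) :
  (forall i j k, S 0 (tidx i j k) = T 0 (tidx i j k)) -> S = T.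
Proof. by move=> eqST; apply/rowP => x; have [i [j [k ->]]] := tidxP x; apply: eqST. Qed.

Lemma map_tsum (R R' : comNzRingType) (phi : {rmorphism R -> R'}) s a b c
    (U : 'M[R]_(s, a)) (V : 'M[R]_(s, b)) (W : 'M[R]_(s, c)) :
  map_mx phi (tsum U V W) = tsum (map_mx phi U) (map_mx phi V) (map_mx phi W).
Proof.
apply: eq_tensor => i j k; rewrite mxE !tsumE rmorph_sum.
by apply: eq_bigr => p _; rewrite !rmorphM !mxE.
Qed.

Lemma tsumZ (R : comNzRingType) s a b c t
    (U : 'M[R]_(s, a)) (V : 'M[R]_(s, b)) (W : 'M[R]_(s, c)) :
  t *: tsum U V W = tsum (t *: U) V W.
Proof.
apply: eq_tensor => i j k; rewrite mxE !tsumE mulr_sumr.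
by apply: eq_bigr => p _; rewrite mxE !mulrA.
Qed.

Lemma rank1Zl (R : comNzRingType) a b c t (u : 'rV[R]_a) (v : 'rV[R]_b) (w : 'rV[R]_c) :
  t *: rank1 u v w = rank1 (t *: u) v w.
Proof. by apply: eq_tensor => i j k; rewrite mxE !rank1E mxE !mulrA. Qed.

Lemma rank1_neq0 (K : fieldType) a b c (u : 'rV[K]_a) (v : 'rV[K]_b) (w : 'rV[K]_c) :
  rank1 u v w != 0 -> [/\ u != 0, v != 0 & w != 0].
Proof.
by move=> T_neq0; split; apply: contra_neq T_neq0 => ->; apply: eq_tensor => i j k;
  rewrite rank1E !mxE ?mulr0 ?mul0r.
Qed.

(** The scalars of a point of a span of lines are absorbed in the first factors. *)
Lemma secant_union_tsum (K : fieldType) s a b c (Q : proj_space _) x :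
  secant_union s (@segre K a b c) Q -> x \in val Q ->
  exists U V W, x = tsum (s := s) U V W.
Proof.
case=> P P_segre; rewrite /lin_span => sQP /(subvP sQP) /memv_sumP [y y_in ->].
have uvw p : exists r : 'rV_a.+1 * 'rV_b.+1 * 'rV_c.+1,
    y p == rank1 r.1.1 r.1.2 r.2.
  have [u [v [w [_ _ _ eP]]]] := P_segre p.
  have := y_in p isT; rewrite eP => /vlineP [t ->]; exists (t *: u, v, w).
  by rewrite -rank1Zl.
pose r p := xchoose (uvw p).
exists (\matrix_p (r p).1.1), (\matrix_p (r p).1.2), (\matrix_p (r p).2).
by apply: eq_bigr => p _; rewrite !rowK; apply/eqP; apply: (xchooseP (uvw p)).
Qed.

(** The summands that vanish do not define points of the Segre variety; they are
    replaced by a nonzero one. *)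
Lemma tsum_secant_union (K : fieldType) s a b c (Q : proj_space _)
    (U : 'M[K]_(s, a.+1)) (V : 'M[K]_(s, b.+1)) (W : 'M[K]_(s, c.+1)) :
  tsum U V W != 0 -> val Q = <[tsum U V W]>%VS -> secant_union s (@segre K a b c) Q.
Proof.
move=> T_neq0 eQ; pose T p := rank1 (row p U) (row p V) (row p W).
have [p0 Tp0] : exists p0, T p0 != 0.
  apply/existsP; apply: contra_neqT T_neq0; rewrite negb_exists => /forallP T0.
  by apply: big1 => p _; apply/eqP; have := T0 p; rewrite negbK.
pose h p := if T p == 0 then p0 else p.
have Th p : T (h p) != 0 by rewrite /h; case: ifP => // ->.
have line p : \dim <[T (h p)]>%VS == 1%N by rewrite dim_vline Th.
exists (fun p => exist _ <[T (h p)]>%VS (line p)) => [p|].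
  have [u0 v0 w0] := rank1_neq0 (Th p).
  by exists (row (h p) U), (row (h p) V), (row (h p) W).
rewrite /lin_span eQ /= -memvE; apply: memv_suml => p _.
have [T0|T_p] := eqVneq (T p) 0; first by rewrite -/(T p) T0 mem0v.
apply: (subvP (sumv_sup p _ (subvv _))) => //.
by rewrite /h (negPf T_p) memv_line.
Qed.

Lemma meval_dhomog (K : comNzRingType) n (f : {mpoly K[n]}) d t x :
  f \is d.-homog -> f.@[fun i => t * x i] = t ^+ d * f.@[x].
Proof.
move=> /dhomogP f_homog; rewrite !mevalE mulr_sumr; apply: eq_big_seq => m m_in.
rewrite mulrCA; congr (_ * _); rewrite -(f_homog m m_in) /= mdegE expr_sum -big_split.
by apply: eq_bigr => i _; rewrite exprMn.
Qed.

Definition vanishes_on_secants (K : fieldType) s a b c (f : {mpoly K[a * (b * c)]}) :=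
  forall (U : 'M_(s, a)) (V : 'M_(s, b)) (W : 'M_(s, c)), f.@[tsum U V W 0] = 0.

(** Reduces the ideal of the secant variety to a polynomial identity on the cone
    over it.  At the zero tensor the value of [f] is 0 ^+ d times its value at any
    nonzero tensor of the cone, which also covers constant [f]. *)
Lemma vanishes_secant_variety (K : fieldType) s a b c f :
  homogeneous f ->
  (forall Q, secant_variety s.+1 (@segre K a b c) Q -> vanishes_at f Q) <->
  vanishes_on_secants s.+1 f.
Proof.
move=> f_homog; split=> [f_van U V W | f_van Q QX].
  have [d f_d] := f_homog.
  have f0 (U' : 'M_(s.+1, _)) V' W' : tsum U' V' W' != 0 -> f.@[tsum U' V' W' 0] = 0.
    move=> T_neq0; have line : \dim <[tsum U' V' W']>%VS == 1%N by rewrite dim_vline T_neq0.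
    pose Q : proj_space _ := exist (fun L : {vspace _} => \dim L == 1%N) _ line.
    apply: (f_van Q _ (tsum U' V' W')); last exact: memv_line.
    by move=> Z _; apply; apply: (tsum_secant_union T_neq0).
  have [->|] := eqVneq (tsum U V W) 0; last exact: f0.
  pose E n : 'M[K]_(s.+1, n.+1) := \matrix_(p, i) (p == 0)%:R.
  have E0 : tsum (E a) (E b) (E c) != 0.
    apply/eqP => /rowP/(_ (tidx 0 0 0)); rewrite tsumE big_ord_recl big1 => [|p _].
      by rewrite !mxE eqxx !mulr1 addr0 => /eqP; rewrite oner_eq0.
    by rewrite !mxE eq_sym (negPf (neq_lift _ _)) !mul0r.
  transitivity (0 ^+ d * f.@[tsum (E a) (E b) (E c) 0]); last by rewrite f0 ?mulr0.
  by rewrite -meval_dhomog //; apply: meval_eq => x; rewrite mxE mul0r.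
apply: (QX (fun Q => vanishes_at f Q)) => [|P PX x x_in].
  exists (fun g => g = f) => [g -> //|P]; split=> [fP g -> //|]; exact.
by have [U [V [W ->]]] := secant_union_tsum PX x_in.
Qed.

(** * Tensors in the span of a rational curve *)

(** For the curve A(s) (x) B(s) (x) C(s), whose coefficient of s^n is a tensor,
    this is the image of the coefficients under s^n |-> h n; these tensors form the
    linear span of the curve. *)
Definition curve_tensor (R : comNzRingType) d e f a b c (A : 'M[R]_(d, a)) (B : 'M[R]_(e, b))
    (C : 'M[R]_(f, c)) (h : nat -> R) :=
  \sum_(i < d) \sum_(j < e) \sum_(k < f) h (i + j + k)%N *: rank1 (row i A) (row j B) (row k C).

Lemma curve_tensorE (R : comNzRingType) d e f a b c (A : 'M[R]_(d, a)) (B : 'M[R]_(e, b))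
    (C : 'M[R]_(f, c)) h i j k :
  curve_tensor A B C h 0 (tidx i j k) =
    \sum_(i' < d) \sum_(j' < e) \sum_(k' < f) h (i' + j' + k')%N * (A i' i * B j' j * C k' k).
Proof.
rewrite !summxE; apply: eq_bigr => i' _; rewrite !summxE; apply: eq_bigr => j' _.
by rewrite !summxE; apply: eq_bigr => k' _; rewrite mxE rank1E !mxE.
Qed.

Definition curve_at (R : comNzRingType) d a (A : 'M[R]_(d, a)) (s : R) : 'rV_a :=
  \sum_(i < d) s ^+ i *: row i A.

(** Evaluation at [s] is the functional that corresponds to a point of the curve. *)
Lemma curve_tensor_power (R : comNzRingType) d e f a b c (A : 'M[R]_(d, a)) (B : 'M[R]_(e, b))
    (C : 'M[R]_(f, c)) s :
  curve_tensor A B C (fun n => s ^+ n) = rank1 (curve_at A s) (curve_at B s) (curve_at C s).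
Proof.
apply: eq_tensor => i j k; rewrite curve_tensorE rank1E !summxE !mulr_suml.
apply: eq_bigr => i' _; rewrite -mulrA mulr_suml mulr_sumr; apply: eq_bigr => j' _.
by rewrite !mulr_sumr; apply: eq_bigr => k' _; rewrite !mxE !exprD; ring.
Qed.

(** The leading coefficient plays the role of evaluation at infinity. *)
Lemma curve_tensor_top (R : comNzRingType) d e f a b c (A : 'M[R]_(d.+1, a)) (B : 'M[R]_(e.+1, b))
    (C : 'M[R]_(f.+1, c)) :
  curve_tensor A B C (fun n => (n == d + e + f)%N%:R) =
    rank1 (row ord_max A) (row ord_max B) (row ord_max C).
Proof.
rewrite /curve_tensor (bigD1 ord_max) //= (bigD1 ord_max) //= (bigD1 ord_max) //=.
rewrite eqxx scale1r !big1 ?addr0 // => [i /eqP neq_i|j /eqP neq_j|k /eqP neq_k].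
- apply: big1 => j _; apply: big1 => k _; case: eqP; rewrite ?scale0r // => eq_ijk.
  case: neq_i; apply: val_inj => /=.
  have := ltn_ord i; have := ltn_ord j; have := ltn_ord k.
  by move: eq_ijk; lia.
- apply: big1 => k _; case: eqP; rewrite ?scale0r // => eq_jk.
  case: neq_j; apply: val_inj => /=.
  by have := ltn_ord j; have := ltn_ord k; move: eq_jk => /=; lia.
case: eqP; rewrite ?scale0r // => eq_k.
by case: neq_k; apply: val_inj => /=; move: eq_k => /=; lia.
Qed.

Lemma curve_tensor_sum (R : comNzRingType) d e f a b c (A : 'M[R]_(d, a)) (B : 'M[R]_(e, b))
    (C : 'M[R]_(f, c)) m (t : 'I_m -> R) (h : 'I_m -> nat -> R) h' :
  curve_tensor A B C (fun n => \sum_p t p * h p n + h' n) =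
    \sum_p t p *: curve_tensor A B C (h p) + curve_tensor A B C h'.
Proof.
apply: eq_tensor => i j k; rewrite mxE !curve_tensorE summxE.
under [X in _ = X + _]eq_bigr do rewrite mxE curve_tensorE mulr_sumr.
rewrite [X in _ = X + _]exchange_big -big_split; apply: eq_bigr => i' _ /=.
under [X in _ = X + _]eq_bigr do rewrite mulr_sumr.
rewrite [X in _ = X + _]exchange_big -big_split; apply: eq_bigr => j' _ /=.
under [X in _ = X + _]eq_bigr do rewrite mulr_sumr.
rewrite [X in _ = X + _]exchange_big -big_split; apply: eq_bigr => k' _ /=.
rewrite mulrDl mulr_suml; congr (_ + _).
by apply: eq_bigr => p _; rewrite !mulrA.
Qed.

(** Lagrange interpolation: the sum of the [z j] V_j times the product of the
    x - s_k for k distinct from j is proportional to V_j at s_j, and its leading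
    coefficient, the value at infinity, is the sum of the [z j] V_j.  So a curve of
    degree m passes through m + 2 general points, the last one at infinity. *)
Lemma interpolating_curve (R : comNzRingType) m n (s z : 'I_m.+1 -> R) (V : 'M[R]_(m.+1, n)) :
  exists B : 'M_(m.+1, n),
    [/\ forall x, curve_at B x = \sum_j (z j * \prod_(k | k != j) (x - s k)) *: row j V,
        forall j, curve_at B (s j) = (z j * \prod_(k | k != j) (s j - s k)) *: row j V
      & row ord_max B = \sum_j z j *: row j V].
Proof.
pose l j : {poly R} := \prod_(k | k != j) ('X - (s k)%:P).
have size_l j : size (l j) = m.+1.
  by rewrite /l -big_filter size_prod_XsubC -sum1_size big_filter sum1_card cardC1 card_ord.
have l_top j : (l j)`_m = 1.
  have : l j \is monic by apply: monic_prod_XsubC.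
  by rewrite monicE lead_coefE size_l => /eqP.
pose B := \matrix_(i < m.+1, k < n) \sum_j (z j * (l j)`_i) * V j k.
have B_at x : curve_at B x = \sum_j (z j * \prod_(k | k != j) (x - s k)) *: row j V.
  apply/rowP => k.
  rewrite !summxE; under eq_bigr do rewrite !mxE mulr_sumr.
  rewrite exchange_big; apply: eq_bigr => j _; rewrite !mxE.
  have -> : \prod_(k0 | k0 != j) (x - s k0) = (l j).[x].
    by rewrite horner_prod; apply: eq_bigr => k0 _; rewrite hornerXsubC.
  rewrite (horner_coef_wide _ (_ : size (l j) <= m.+1)%N) ?size_l // mulr_sumr mulr_suml.
  by apply: eq_bigr => i _; ring.
exists B; split=> // [j|]; last apply/rowP => k.
  rewrite B_at (bigD1 j) //= [X in _ + X]big1 ?addr0 // => i neq_ij.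
  by rewrite (bigD1 j) 1?eq_sym //= subrr mul0r mulr0 scale0r.
by rewrite !mxE summxE; apply: eq_bigr => j _; rewrite !mxE l_top mulr1.
Qed.

(** By Cramer's rule, the coordinates of the last [r] rows in the basis of the
    first [m] rows, times the determinant of that basis: polynomial in [X]. *)
Definition minor_coords (R : comNzRingType) m r (X : 'M[R]_(m + r, m)) : 'M_(r, m) :=
  dsubmx X *m \adj (usubmx X).

Lemma row_minor_coords (K : fieldType) m r (X : 'M[K]_(m + r, m)) i :
  \det (usubmx X) != 0 ->
  row (rshift m i) X = \sum_j (minor_coords X i j / \det (usubmx X)) *: row (lshift r j) X.
Proof.
move=> D_neq0; have : row i (dsubmx X) = (\det (usubmx X))^-1 *: row i (minor_coords X *m usubmx X).
  by rewrite -mulmxA mul_adj_mx mul_mx_scalar [in RHS]linearZ scalerA mulVf ?scale1r.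
rewrite row_dsubmx => ->; rewrite row_mul mulmx_sum_row scaler_sumr; apply: eq_bigr => j _.
by rewrite row_usubmx scalerA mulrC !mxE.
Qed.

(** For U: the first three vectors are a basis, and the ratios s_i = y_i / x_i of
    the coordinates of the last two vectors are defined, nonzero and distinct.
    For V and W: the first four vectors are a basis in which the fifth has no
    coordinate zero.  These are polynomial conditions, so that density applies. *)
Definition general_position (R : comNzRingType)
    (U : 'M[R]_(3 + 2, 3)) (V W : 'M[R]_(4 + 1, 4)) : R :=
  let u := minor_coords U in
  (\det (usubmx U) * \prod_i (u 0 i * u 1 i) *
     \prod_i \prod_(j | j != i) (u 0 i * u 1 j - u 0 j * u 1 i)) *
  (\det (usubmx V) * \prod_j minor_coords V 0 j) *
  (\det (usubmx W) * \prod_j minor_coords W 0 j).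

(** The twisted cubic through the five points, the last of them at infinity. *)
Lemma general_curve4 (K : fieldType) (s : 'I_4 -> K) (V : 'M[K]_(4 + 1, 4)) :
  injective s -> \det (usubmx V) * \prod_j minor_coords V 0 j != 0 ->
  exists (B : 'M_(4, 4)) (c : 'I_4 -> K),
    [/\ forall j, c j != 0,
        forall j, curve_at B (s j) = c j *: row (lshift 1 j) V
      & row ord_max B = row (rshift 4 0) V].
Proof.
move=> s_inj; rewrite mulf_eq0 negb_or => /andP [D_neq0 /prodf_neq0 z_neq0].
pose z j := minor_coords V 0 j / \det (usubmx V).
have [B [_ B_at B_top]] := interpolating_curve s z (usubmx V).
exists B, (fun j => z j * \prod_(k | k != j) (s j - s k)); split=> [j|j|].
- rewrite mulf_neq0 ?mulf_neq0 ?invr_eq0 ?z_neq0 //; apply/prodf_neq0 => k neq_kj.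
  by rewrite subr_eq0 (inj_eq s_inj) eq_sym.
- by rewrite B_at row_usubmx.
rewrite B_top row_minor_coords //; apply: eq_bigr => j _; by rewrite row_usubmx.
Qed.

(** The conic through the five points of P^2, with the last two at 0 and at
    infinity; the parameters of the first three are then forced to be the ratios
    y_i / x_i of the coordinates of the last two points. *)
Lemma general_curve3 (K : fieldType) (U : 'M[K]_(3 + 2, 3)) (u := minor_coords U) :
  \det (usubmx U) * \prod_i (u 0 i * u 1 i) *
     \prod_i \prod_(j | j != i) (u 0 i * u 1 j - u 0 j * u 1 i) != 0 ->
  exists (s : 'I_4 -> K) (A : 'M_(3, 3)) (c : 'I_4 -> K),
    [/\ injective s, forall j, c j != 0,
        forall j, curve_at A (s j) = c j *: row (lshift 1 j : 'I_(3 + 2)) U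
      & row ord_max A = row (rshift 4 (0 : 'I_1) : 'I_(3 + 2)) U].
Proof.
rewrite !mulf_eq0 !negb_or -andbA => /and3P [D_neq0 /prodf_neq0 xy_neq0 /prodf_neq0 s_neq].
have x_neq0 i : u 0 i != 0 by have := xy_neq0 i isT; rewrite mulf_eq0 negb_or => /andP [].
have y_neq0 i : u 1 i != 0 by have := xy_neq0 i isT; rewrite mulf_eq0 negb_or => /andP [].
pose s0 i := u 1 i / u 0 i.
have s0_inj : injective s0.
  move=> i j /eqP; rewrite /s0 eqr_div // => /eqP eq_ij; apply/eqP.
  have /prodf_neq0/(_ j) := s_neq i isT; rewrite eq_sym.
  case: eqP => // _ /(_ isT); rewrite subr_eq0 mulrC [u 0 j * _]mulrC eq_ij.
  by rewrite eqxx.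
pose s (j : 'I_4) := oapp s0 0 (unlift ord_max j).
pose y i := u 1 i / \det (usubmx U).
have s0_neq0 i : s0 i != 0 by rewrite mulf_neq0 ?invr_eq0.
have [A [A_all A_at A_top]] := interpolating_curve s0 y (usubmx U).
pose c (j : 'I_4) :=
  if unlift ord_max j is Some i then y i * \prod_(k | k != i) (s0 i - s0 k) else \prod_i s0 i.
exists s, A, c; split=> [j k|j|j|].
- rewrite /s; case: (unliftP ord_max j) => [i ->|->]; case: (unliftP ord_max k) => [l ->|->] //=.
  + by move/s0_inj ->.
  + by move/eqP; rewrite (negPf (s0_neq0 i)).
  + by move/esym/eqP; rewrite (negPf (s0_neq0 l)).
- rewrite /c; case: unliftP => [i _|_]; last by apply/prodf_neq0 => i _.
  rewrite mulf_neq0 ?mulf_neq0 ?invr_eq0 //; apply/prodf_neq0 => k neq_ki.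
  by rewrite subr_eq0 (inj_eq s0_inj) eq_sym.
- rewrite /s /c; case: (unliftP ord_max j) => [i ->|->] /=.
    rewrite A_at row_usubmx; congr (_ *: row _ U); apply: val_inj => /=.
    by rewrite /bump leqNgt ltn_ord.
  rewrite A_all; have -> : (lshift 1 (@ord_max 3) : 'I_5) = rshift 3 (0 : 'I_2) by apply: val_inj.
  rewrite row_minor_coords // scaler_sumr; apply: eq_bigr => i _.
  rewrite row_usubmx scalerA; congr (_ *: _).
  under eq_bigr do rewrite sub0r.
  (* The sign (-1) ^ 2 is where the number of finite nodes, three, enters. *)
  rewrite prodrN cardC1 card_ord [in RHS](bigD1 i) //= /y /s0 -/u.
  by field; rewrite D_neq0 x_neq0.
rewrite A_top; have -> : (rshift 4 (0 : 'I_1) : 'I_5) = rshift 3 (1 : 'I_2) by apply: val_inj.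
rewrite row_minor_coords //; apply: eq_bigr => i _; by rewrite row_usubmx.
Qed.

(** The conic determines the five parameters and the twisted cubics are taken with
    the same ones; [h] is a weighted sum of the evaluations at these parameters,
    whose weights undo the proportionality factors. *)
Lemma general_position_curve (K : fieldType) (U : 'M[K]_(5, 3)) (V W : 'M[K]_(5, 4)) :
  general_position U V W != 0 ->
  exists (A : 'M_(3, 3)) (B C : 'M_(4, 4)) h, tsum U V W = curve_tensor A B C h.
Proof.
rewrite /general_position mulf_eq0 negb_or => /andP [].
rewrite mulf_eq0 negb_or => /andP [/general_curve3 [s [A [a [s_inj a0 A_at A_top]]]]].
move=> /(general_curve4 s_inj) [B [b [b0 B_at B_top]]].
move=> /(general_curve4 s_inj) [C [c [c0 C_at C_top]]].
pose t p := (a p * b p * c p)^-1.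
exists A, B, C, (fun n => \sum_p t p * s p ^+ n + (n == 2 + 3 + 3)%N%:R).
rewrite curve_tensor_sum curve_tensor_top A_top B_top C_top.
rewrite /tsum (@big_split_ord _ _ _ 4 1) /= big_ord1; congr (_ + _).
apply: eq_bigr => p _; rewrite curve_tensor_power A_at B_at C_at.
apply: eq_tensor => i j k; rewrite mxE !rank1E !mxE /t.
by field; rewrite a0 b0 c0.
Qed.

(** * Density of the tensors supported on rational curves *)

(** Coordinate points together with (1, 1, 1) and (1, 2, 3): the ratios in
    [general_position] are 1, 2 and 3. *)
Definition base_U (R : comNzRingType) : 'M[R]_(3 + 2, 3) :=
  col_mx 1%:M (\matrix_(r < 2, k < 3) k.+1%:R ^+ r).
Definition base_V (R : comNzRingType) : 'M[R]_(4 + 1, 4) := col_mx 1%:M (const_mx 1).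

Lemma general_position_base (K : fieldType) : [pchar K] =i pred0 ->
  general_position (base_U K) (base_V K) (base_V K) != 0.
Proof.
move=> char0; have natr_inj := natr_inj_pchar0 char0.
rewrite /general_position /minor_coords !col_mxKu !col_mxKd !adj1 !mulmx1 !det1 !mul1r.
have V_neq0 : \prod_j (const_mx 1 : 'M[K]_(1, 4)) 0 j != 0.
  by rewrite big1 ?oner_eq0 // => j _; rewrite mxE.
rewrite !mulf_neq0 //; apply/prodf_neq0 => i _.
  rewrite !mxE expr0 expr1 mul1r; apply/eqP => /(natr_inj _ 0%N); lia.
apply/prodf_neq0 => j neq_ji; rewrite !mxE expr0 expr1 !mul1r subr_eq0.
by apply: contraNneq neq_ji => /natr_inj [eq_ji]; apply/eqP/val_inj.
Qed.

Lemma map_minor_coords (R R' : comNzRingType) (phi : {rmorphism R -> R'}) m r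
    (X : 'M[R]_(m + r, m)) :
  minor_coords (map_mx phi X) = map_mx phi (minor_coords X).
Proof. by rewrite /minor_coords map_mxM map_mx_adj map_usubmx map_dsubmx. Qed.

Lemma map_general_position (R R' : comNzRingType) (phi : {rmorphism R -> R'})
    (U : 'M[R]_(3 + 2, 3)) (V W : 'M[R]_(4 + 1, 4)) :
  general_position (map_mx phi U) (map_mx phi V) (map_mx phi W) =
    phi (general_position U V W).
Proof.
rewrite /general_position !map_minor_coords -!map_usubmx !det_map_mx !rmorphM.
congr (_ * _ * _ * (_ * _) * (_ * _)); rewrite rmorph_prod; apply: eq_bigr => i _.
- by rewrite !mxE rmorphM.
- by rewrite rmorph_prod; apply: eq_bigr => j _; rewrite !mxE rmorphB !rmorphM.
- by rewrite mxE.
by rewrite mxE.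
Qed.

(** On the line from the base point to (U, V, W), the polynomial [f] vanishes
    wherever [general_position] does not, and [general_position] is not identically
    zero there, since it is nonzero at the base point. *)
Lemma vanishes_on_secants_dense (K : fieldType) (f : {mpoly K[3 * (4 * 4)]}) :
  [pchar K] =i pred0 ->
  (forall U V W, general_position U V W != 0 ->
     f.@[tsum (U : 'M_(5, 3)) (V : 'M_(5, 4)) (W : 'M_(5, 4)) 0] = 0) ->
  vanishes_on_secants 5 f.
Proof.
move=> char0 f_gen U V W.
(* The matrices X + t (Y - X), with t the variable of a polynomial ring. *)
pose line m n (X Y : 'M[K]_(m, n)) := map_mx polyC X + 'X *: map_mx polyC (Y - X).
have line_at m n (X Y : 'M[K]_(m, n)) t :
    map_mx (horner_eval t) (line m n X Y) = X + t *: (Y - X).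
  by apply/matrixP => i j; rewrite !mxE /horner_eval !hornerE.
pose U' := line _ _ (base_U K) U; pose V' := line _ _ (base_V K) V.
pose W' := line _ _ (base_V K) W.
pose F := mmap polyC (tsum (s := 5) U' V' W' 0) f.
pose q := general_position U' V' W'.
have q_neq0 : q != 0.
  apply: contra_neq (general_position_base char0) => q_eq0.
  rewrite -[RHS](horner0 0) -q_eq0 -[q.[0]]/(horner_eval 0 q) -map_general_position !line_at.
  by rewrite !scale0r !addr0.
have F_at t : F.[t] = f.@[tsum (s := 5) (map_mx (horner_eval t) U')
    (map_mx (horner_eval t) V') (map_mx (horner_eval t) W') 0].
  rewrite -[F.[t]]/(horner_eval t F) rmorph_mmap; apply: eq_mmap => [c|i] /=.
    by rewrite /horner_eval hornerC.
  by rewrite -map_tsum mxE.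
have /eqP : q * F = 0.
  apply: poly_vanish => // t; rewrite hornerM.
  have [->|] := eqVneq q.[t] 0; first by rewrite mul0r.
  rewrite -[q.[t]]/(horner_eval t q) -map_general_position => /f_gen.
  by rewrite F_at => ->; rewrite mulr0.
rewrite mulf_eq0 (negPf q_neq0) => /eqP F0.
have := F_at 1; rewrite F0 horner0 !line_at !scale1r ![_ + (_ - _)]addrC !subrK.
by move/esym.
Qed.

(** The values at [x] of the homogeneous components are the coefficients of the
    polynomial t |-> f(t x). *)
Lemma pihomog_vanish (K : fieldType) n (f : {mpoly K[n]}) x d : [pchar K] =i pred0 ->
  (forall t, f.@[fun i => t * x i] = 0) -> (pihomog mdeg d f).@[x] = 0.
Proof.
move=> char0 f_eq0; pose k := maxn (msize f) d.+1.
pose P := \poly_(e < k) (pihomog mdeg e f).@[x].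
have P0 : P = 0.
  apply: poly_vanish => // t; rewrite horner_poly -[RHS](f_eq0 t).
  rewrite [in RHS](pihomog_partitionE (leq_maxl (msize f) d.+1)) raddf_sum.
  by apply: eq_bigr => e _; rewrite /= (meval_dhomog _ _ (pihomogP _ _ _)) mulrC.
by have := coef_poly k (fun e => (pihomog mdeg e f).@[x]) d; rewrite -/P P0 coef0 leq_maxr.
Qed.

(** The 50 parameters: the entries of A, B and C, and the values h 0, ..., h 8. *)
Definition curve_index : finType := ('I_3 * 'I_3 + 'I_4 * 'I_4 + 'I_4 * 'I_4 + 'I_9)%type.

Lemma card_curve_index : #|curve_index| = 50.
Proof. by rewrite !card_sum !card_prod !card_ord. Qed.

Definition param_A R (e : curve_index -> R) := \matrix_(i < 3, j < 3) e (inl (inl (inl (i, j)))).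
Definition param_B R (e : curve_index -> R) := \matrix_(i < 4, j < 4) e (inl (inl (inr (i, j)))).
Definition param_C R (e : curve_index -> R) := \matrix_(i < 4, j < 4) e (inl (inr (i, j))).
Definition param_h R (e : curve_index -> R) n := e (inr (inord n)).

Definition param_tensor (R : comNzRingType) (e : curve_index -> R) :=
  curve_tensor (param_A e) (param_B e) (param_C e) (param_h e).

Definition cvar (K : fieldType) (i : curve_index) : {mpoly K[#|curve_index|]} :=
  'X_(enum_rank i).

Lemma map_param_tensor (R R' : comNzRingType) (phi : {rmorphism R -> R'}) e :
  map_mx phi (param_tensor e) = param_tensor (phi \o e).
Proof.
apply: eq_tensor => i j k; rewrite mxE !curve_tensorE rmorph_sum; apply: eq_bigr => i' _.
rewrite rmorph_sum; apply: eq_bigr => j' _; rewrite rmorph_sum; apply: eq_bigr => k' _.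
by rewrite !rmorphM !mxE.
Qed.

Lemma curve_tensor_param (R : comNzRingType) (A : 'M[R]_3) (B C : 'M[R]_4) h :
  exists e, curve_tensor A B C h = param_tensor e.
Proof.
exists (fun x : curve_index => match x with
  | inl (inl (inl (i, j))) => A i j | inl (inl (inr (i, j))) => B i j
  | inl (inr (i, j)) => C i j | inr n => h (nat_of_ord n) end).
apply: eq_tensor => i j k; rewrite !curve_tensorE.
apply: eq_bigr => i' _; apply: eq_bigr => j' _; apply: eq_bigr => k' _.
rewrite !mxE /param_h inordK //.
have := ltn_ord i'; have := ltn_ord j'; have := ltn_ord k'; lia.
Qed.

(** A relation between the entries of the generic [param_tensor] holds on the
    whole secant variety; its homogeneous components inherit this because [h] can be
    rescaled. *)
Lemma curve_relations_vanish (K : fieldType) (f : {mpoly K[3 * (4 * 4)]}) d :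
  [pchar K] =i pred0 ->
  mmap (@mpolyC _ K) (param_tensor (@cvar K) 0) f = 0 ->
  vanishes_on_secants 5 (pihomog mdeg d f).
Proof.
move=> char0 f_eq0; apply: vanishes_on_secants_dense => // U V W.
move=> /general_position_curve [A [B [C [h ->]]]].
apply: pihomog_vanish => // t.
have [e eT] := curve_tensor_param A B C (fun n => t * h n).
pose y (l : 'I_#|curve_index|) := e (enum_val l).
have := congr1 (meval y) f_eq0; rewrite meval0 rmorph_mmap => <-; apply: eq_mmap => [c|x].
  by rewrite /= mevalC.
have := map_param_tensor (meval y) (@cvar K); move/rowP/(_ x); rewrite mxE /= => ->.
have -> : param_tensor (meval y \o @cvar K) = curve_tensor A B C (fun n => t * h n).
  rewrite eT; apply: eq_tensor => i j k; rewrite !curve_tensorE.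
  apply: eq_bigr => i' _; apply: eq_bigr => j' _; apply: eq_bigr => k' _.
  by rewrite /param_h !mxE /= /cvar !mevalXU /y !enum_rankK.
have [i [j [k ->]]] := tidxP x; rewrite !curve_tensorE mulr_sumr.
apply: eq_bigr => i' _; rewrite mulr_sumr; apply: eq_bigr => j' _; rewrite mulr_sumr.
by apply: eq_bigr => k' _; rewrite !mulrA.
Qed.

(** * The symmetries of the parametrization and the upper bound *)

(** An infinitesimal change of (A, B, C, h), given by its effect on the sequences
    of coefficients of each column. *)
Record action (R : Type) := Action {
  act_A : (nat -> R) -> nat -> R;
  act_B : (nat -> R) -> nat -> R;
  act_C : (nat -> R) -> nat -> R;
  act_h : (nat -> R) -> nat -> R }.

(** The vector field d/ds on the parameter of the curve: it acts on the
    coefficient sequences of degrees 2, 3, 3, and on [h] by the dual action. *)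
Definition translation (R : comNzRingType) : action R :=
  let act d a i := if (i < d)%N then a i.+1 * i.+1%:R else 0 in
  Action (act 2) (act 3) (act 3) (fun h n => - (h n.-1 * n%:R)).

(** The field s^2 d/ds - d s on polynomials of degree [d], for d = 2, 3, 3, and
    its dual on [h] for d = 8; with [translation] it generates sl_2. *)
Definition inversion (R : comNzRingType) : action R :=
  let act d a i := if i is i'.+1 then - (a i' * (d - i')%:R) else 0 in
  Action (act 2) (act 3) (act 3) (fun h n => h n.+1 * (8 - n)%:R).

(** The field s d/ds, with weight [w], together with the scalings of A, B and C
    by [x], [y] and [z], which [h] compensates. *)
Definition rescaling (R : comNzRingType) (x y z w : R) : action R :=
  let act x a i := a i * (x + w * i%:R) in
  Action (act x) (act y) (act z) (fun h n => - (h n * (x + y + z + w * n%:R))).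

(** The derivative of every entry of [curve_tensor A B C h] along [D] is zero. *)
Definition invariant (R : comNzRingType) (D : action R) := forall a b c h : nat -> R,
  \sum_(i < 3) \sum_(j < 4) \sum_(k < 4)
    (act_h D h (i + j + k)%N * (a i * b j * c k) +
     h (i + j + k)%N *
       (act_A D a i * b j * c k + a i * act_B D b j * c k + a i * b j * act_C D c k)) = 0.

Lemma translation_invariant (R : comNzRingType) : invariant (translation R).
Proof. by move=> a b c h; rewrite !big_ord_recl !big_ord0 /= /bump /= ?addnE ?subnE /=; ring. Qed.

Lemma inversion_invariant (R : comNzRingType) : invariant (inversion R).
Proof. by move=> a b c h; rewrite !big_ord_recl !big_ord0 /= /bump /= ?addnE ?subnE /=; ring. Qed.

Lemma rescaling_invariant (R : comNzRingType) x y z w : invariant (@rescaling R x y z w).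
Proof.
move=> a b c h; apply: big1 => i _; apply: big1 => j _; apply: big1 => k _ /=.
by rewrite !natrD; ring.
Qed.

(** [D] as a vector field on the space of parameters: its component at the
    parameter [x]. *)
Definition velocity (R : comNzRingType) (D : action R) (e : curve_index -> R)
    (x : curve_index) : R :=
  match x with
  | inl (inl (inl (i, j))) => act_A D (fun i' => e (inl (inl (inl (inord i', j))))) i
  | inl (inl (inr (i, j))) => act_B D (fun i' => e (inl (inl (inr (inord i', j))))) i
  | inl (inr (i, j)) => act_C D (fun i' => e (inl (inr (inord i', j)))) i
  | inr n => act_h D (param_h e) n
  end.

Definition vector_field (K : fieldType) (D : action {mpoly K[#|curve_index|]})
    (l : 'I_#|curve_index|) :=
  velocity D (@cvar K) (enum_val l).

Lemma vector_field_cvar (K : fieldType) (D : action {mpoly K[#|curve_index|]}) x :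
  derivation (vector_field D) (cvar K x) = velocity D (@cvar K) x.
Proof. by rewrite derivationX /vector_field enum_rankK. Qed.

Lemma derivation_sum (K : fieldType) n m (c : 'I_n -> {mpoly K[n]}) (F : 'I_m -> {mpoly K[n]}) :
  derivation c (\sum_i F i) = \sum_i derivation c (F i).
Proof.
elim/big_rec2: _ => [|i p q _ <-]; last by rewrite derivationD.
by rewrite -mpolyC0 derivationC mpolyC0.
Qed.

Lemma vector_field_param (K : fieldType) (D : action {mpoly K[#|curve_index|]}) l :
  invariant D -> derivation (vector_field D) (param_tensor (@cvar K) 0 l) = 0.
Proof.
move=> D_inv; have [i [j [k ->]]] := tidxP l; rewrite curve_tensorE.
rewrite -[RHS](D_inv (fun n => cvar K (inl (inl (inl (inord n, i)))))
  (fun n => cvar K (inl (inl (inr (inord n, j)))))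
  (fun n => cvar K (inl (inr (inord n, k)))) (param_h (@cvar K))).
rewrite derivation_sum; apply: eq_bigr => i' _; rewrite derivation_sum; apply: eq_bigr => j' _.
rewrite derivation_sum; apply: eq_bigr => k' _.
rewrite !derivationM !mxE /param_h !vector_field_cvar /= !inord_val inordK; first by ring.
have := ltn_ord i'; have := ltn_ord j'; have := ltn_ord k'; lia.
Qed.

(** The fourth field is the scaling of A minus s d/ds: with this combination the
    matrix of [slice_transversal] is diagonal. *)
Definition curve_action (R : comNzRingType) (i : 'I_6) : action R :=
  nth (rescaling 0 0 0 1)
    [:: translation R; rescaling 0 0 0 1; inversion R; rescaling 1 0 0 (-1);
        rescaling 0 1 0 0; rescaling 0 0 1 0] i.

Definition curve_field (K : fieldType) (i : 'I_6) :
    'I_#|curve_index| -> {mpoly K[#|curve_index|]} :=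
  vector_field (curve_action _ i).

(** The six coordinates used to separate the six fields: the column 0 of A, the
    constant term of column 1 of A, and those of column 0 of B and C. *)
Definition slice_coord (i : 'I_6) : curve_index :=
  nth (inr ord0)
    [:: inl (inl (inl (inord 0, inord 0))); inl (inl (inl (inord 1, inord 0)));
        inl (inl (inl (inord 2, inord 0))); inl (inl (inl (inord 0, inord 1)));
        inl (inl (inr (inord 0, inord 0))); inl (inr (inord 0, inord 0))] i.

(** The point A = (s, 1, 0), B = (1, 0, 0, 0), C = (1, 0, 0, 0), h = 0. *)
Definition slice_value (K : fieldType) (x : curve_index) : K :=
  match x with
  | inl (inl (inl (i, j))) => (i + j == 1)%N%:R
  | inl (inl (inr (i, j))) => (i + j == 0)%N%:R
  | inl (inr (i, j)) => (i + j == 0)%N%:R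
  | inr _ => 0
  end.

Definition slice_point (K : fieldType) (l : 'I_#|curve_index|) : K :=
  slice_value K (enum_val l).

Lemma slice_cvar (K : fieldType) x : (cvar K x).@[@slice_point K] = slice_value K x.
Proof. by rewrite mevalXU /slice_point enum_rankK. Qed.

(** At the chosen point each field moves one of the six coordinates and fixes the
    others to first order. *)
Lemma slice_transversal (K : fieldType) (i j : 'I_6) :
  (derivation (curve_field K i) (cvar K (slice_coord j))).@[@slice_point K] =
    (if i == 2%N :> nat then -1 else 1) *+ (i == j).
Proof.
rewrite vector_field_cvar.
case: i => [[|[|[|[|[|[|//]]]]]] lti]; case: j => [[|[|[|[|[|[|//]]]]]] ltj] /=;
  rewrite !inordK //= ?subnE /= ?(mevalD, mevalN, mevalM, meval1, meval0, slice_cvar) ?rmorph_nat /=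
    ?inordK //=; by ring.
Qed.

Lemma proj_dim_le (K : fieldType) r p : [pchar K] =i pred0 ->
  proj_chain (secant_variety 5 (@segre K 2 3 3)) r p -> (r <= 43)%N.
Proof.
move=> char0 chain.
suff: (r.+1 + 6 <= #|curve_index|)%N by rewrite card_curve_index; lia.
have [p_prime p_sec _] := chain.
apply: (proj_chain_bound (psi := param_tensor (@cvar K) 0) (z := cvar K \o slice_coord)
  (c := @curve_field K) (x := @slice_point K)
  (d := fun i => if i == 2%N :> nat then -1 else 1) char0 _ _ _ chain) => [i l|i j|i|f f_eq0].
- apply: vector_field_param; case: i => [[|[|[|[|[|[|//]]]]]] lti] /=;
    [exact: translation_invariant | exact: rescaling_invariant | exact: inversion_invariant
    | exact: rescaling_invariant..].
- exact: slice_transversal.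
- by case: ifP => _; rewrite ?oppr_eq0 oner_eq0.
have [[p0 _ pD] _ _ _] := p_prime 0%N isT.
have f_sec d : pihomog mdeg d f \in p 0%N.
  have f_homog : homogeneous (pihomog mdeg d f) by exists d; exact: pihomogP.
  apply: p_sec => //; apply: (@vanishes_secant_variety K 4 2 3 3 _ f_homog).2.
  exact: curve_relations_vanish.
rewrite (pihomog_partitionE (leqnn (msize f))).
by apply: (big_ind (fun g => g \in p 0%N)) => // u v u_in v_in; rewrite -[u]mul1r; apply: pD.
Qed.

(** * Chains of cones inside the secant variety *)

(** The differential of [tsum]. *)
Definition tangent (R : comNzRingType) s a b c
    (U : 'M[R]_(s, a)) (V : 'M[R]_(s, b)) (W : 'M[R]_(s, c)) dU dV dW :=
  tsum dU V W + tsum U dV W + tsum U V dW.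

Lemma tangentE (R : comNzRingType) s a b c
    (U : 'M[R]_(s, a)) (V : 'M[R]_(s, b)) (W : 'M[R]_(s, c)) dU dV dW i j k :
  tangent U V W dU dV dW 0 (tidx i j k) =
    \sum_(p < s) (dU p i * V p j * W p k + U p i * dV p j * W p k + U p i * V p j * dW p k).
Proof. by rewrite /tangent 2!mxE !tsumE -!big_split. Qed.

(** The directions [dX l] with [l < i] are open, the others are frozen at 0. *)
Definition family (R R' : comNzRingType) (phi : {rmorphism R -> R'}) s a m
    (X0 : 'M[R]_(s, a)) (dX : 'I_m -> 'M[R]_(s, a)) i (y : 'I_m -> R') :=
  map_mx phi X0 + \sum_(l < m | (l < i)%N) y l *: map_mx phi (dX l).

(** The factor [t] makes the image a cone. *)
Definition family_tensor (R R' : comNzRingType) (phi : {rmorphism R -> R'}) s a b c m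
    (U0 : 'M[R]_(s, a)) (V0 : 'M[R]_(s, b)) (W0 : 'M[R]_(s, c))
    (dU : 'I_m -> 'M[R]_(s, a)) (dV : 'I_m -> 'M[R]_(s, b)) (dW : 'I_m -> 'M[R]_(s, c))
    i t (y : 'I_m -> R') :=
  tsum (t *: family phi U0 dU i y) (family phi V0 dV i y) (family phi W0 dW i y).

(** The variable 0 is kept for the factor [t] of [family_tensor]. *)
Definition family_var (K : fieldType) m i (l : 'I_m) : {mpoly K[i.+1]} := 'X_(inord l.+1).

Lemma map_family (R R' R'' : comNzRingType) (phi : {rmorphism R -> R'})
    (psi : {rmorphism R' -> R''}) s a m (X0 : 'M[R]_(s, a)) (dX : 'I_m -> 'M[R]_(s, a)) i y :
  map_mx psi (family phi X0 dX i y) = family (psi \o phi) X0 dX i (psi \o y).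
Proof.
rewrite /family map_mxD -map_mx_comp; congr (_ + _).
by rewrite raddf_sum; apply: eq_bigr => l _ /=; rewrite map_mxZ -map_mx_comp.
Qed.

Lemma map_family_tensor (R R' R'' : comNzRingType) (phi : {rmorphism R -> R'})
    (psi : {rmorphism R' -> R''}) s a b c m
    (U0 : 'M[R]_(s, a)) (V0 : 'M[R]_(s, b)) (W0 : 'M[R]_(s, c))
    (dU : 'I_m -> _) (dV : 'I_m -> _) (dW : 'I_m -> _) i t y :
  map_mx psi (family_tensor phi U0 V0 W0 dU dV dW i t y) =
    family_tensor (psi \o phi) U0 V0 W0 dU dV dW i (psi t) (psi \o y).
Proof. by rewrite map_tsum map_mxZ !map_family. Qed.

Lemma family_tensorZ (R R' : comNzRingType) (phi : {rmorphism R -> R'}) s a b c m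
    (U0 : 'M[R]_(s, a)) (V0 : 'M[R]_(s, b)) (W0 : 'M[R]_(s, c))
    (dU : 'I_m -> _) (dV : 'I_m -> _) (dW : 'I_m -> _) i t y t' :
  t' *: family_tensor phi U0 V0 W0 dU dV dW i t y =
    family_tensor phi U0 V0 W0 dU dV dW i (t' * t) y.
Proof. by rewrite /family_tensor tsumZ scalerA. Qed.

Lemma eq_family (R R' : comNzRingType) (phi psi : {rmorphism R -> R'}) s a m
    (X0 : 'M[R]_(s, a)) (dX : 'I_m -> 'M[R]_(s, a)) i y z :
  phi =1 psi -> (forall l : 'I_m, (l < i)%N -> y l = z l) ->
  family phi X0 dX i y = family psi X0 dX i z.
Proof.
move=> eq_phi eq_yz; rewrite /family (eq_map_mx _ eq_phi); congr (_ + _).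
by apply: eq_bigr => l /eq_yz ->; rewrite (eq_map_mx _ eq_phi).
Qed.

Definition generic_tensor (K : fieldType) s a b c m
    (U0 : 'M[K]_(s, a)) (V0 : 'M[K]_(s, b)) (W0 : 'M[K]_(s, c))
    (dU : 'I_m -> _) (dV : 'I_m -> _) (dW : 'I_m -> _) i :=
  family_tensor (@mpolyC i.+1 K) U0 V0 W0 dU dV dW i 'X_0 (@family_var K m i).

Definition family_ideal (K : fieldType) s a b c m
    (U0 : 'M[K]_(s, a)) (V0 : 'M[K]_(s, b)) (W0 : 'M[K]_(s, c))
    (dU : 'I_m -> _) (dV : 'I_m -> _) (dW : 'I_m -> _) i :
    {pred {mpoly K[a * (b * c)]}} :=
  fun f => mmap (@mpolyC i.+1 K) (generic_tensor U0 V0 W0 dU dV dW i 0) f == 0.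

Lemma family_idealP (K : fieldType) s a b c m
    (U0 : 'M[K]_(s, a)) (V0 : 'M[K]_(s, b)) (W0 : 'M[K]_(s, c))
    (dU : 'I_m -> _) (dV : 'I_m -> _) (dW : 'I_m -> _) i f :
  [pchar K] =i pred0 -> (i <= m)%N ->
  reflect (forall t y, f.@[family_tensor idfun U0 V0 W0 dU dV dW i t y 0] = 0)
    (f \in family_ideal U0 V0 W0 dU dV dW i).
Proof.
move=> char0 le_im.
have evalE x : (mmap (@mpolyC i.+1 K) (generic_tensor U0 V0 W0 dU dV dW i 0) f).@[x] =
    f.@[family_tensor idfun U0 V0 W0 dU dV dW i (x 0) (fun l => x (inord l.+1)) 0].
  rewrite rmorph_mmap; apply: eq_mmap => [e|k] /=; first by rewrite mevalC.
  have := map_family_tensor (@mpolyC i.+1 K) (meval x) U0 V0 W0 dU dV dW i 'X_0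
    (@family_var K m i).
  move/rowP/(_ k); rewrite mxE => ->.
  rewrite /family_tensor /= mevalXU; 
  have eqF n (X0 : 'M[K]_(s, n)) dX :
      family (meval x \o @mpolyC i.+1 K) X0 dX i (meval x \o @family_var K m i) =
      family idfun X0 dX i (fun l => x (inord l.+1)).
    apply: eq_family => [e|l _] /=; first by rewrite mevalC.
    by rewrite mevalXU.
  by rewrite !eqF.
rewrite unfold_in; apply: (iffP eqP) => [f_eq0 t y|f_eq0]; last first.
  by apply: mpoly_vanish => // x; rewrite evalE.
pose x (k : 'I_i.+1) := if unlift 0 k is Some l then y (widen_ord le_im l) else t.
have := evalE x; rewrite f_eq0 meval0 => /esym f0; rewrite -[RHS]f0.
have x_l (l : 'I_m) : (l < i)%N -> y l = x (inord l.+1).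
  move=> lt_li; have -> : inord l.+1 = lift ord0 (Ordinal lt_li).
    by apply: val_inj; rewrite /= inordK.
  by rewrite /x liftK; congr y; apply: val_inj.
have -> : x 0 = t by rewrite /x unlift_none.
have eqF n (X0 : 'M[K]_(s, n)) dX :
    family idfun X0 dX i y = family idfun X0 dX i (fun l => x (inord l.+1)).
  exact: eq_family.
by rewrite /family_tensor !eqF.
Qed.

(** The kernel of a morphism to a domain is prime; it is homogeneous because the
    image of the parametrization is a cone. *)
Lemma family_prime (K : fieldType) s a b c m
    (U0 : 'M[K]_(s, a)) (V0 : 'M[K]_(s, b)) (W0 : 'M[K]_(s, c))
    (dU : 'I_m -> _) (dV : 'I_m -> _) (dW : 'I_m -> _) i :
  [pchar K] =i pred0 -> (i <= m)%N -> tsum U0 V0 W0 != 0 ->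
  proj_prime (family_ideal U0 V0 W0 dU dV dW i).
Proof.
move=> char0 le_im T0_neq0; rewrite /family_ideal; split=> [|f g|f d f_in|].
- split=> [||f g h]; rewrite !unfold_in ?rmorph0 ?rmorph1 ?oner_eq0 //.
  by rewrite rmorphD rmorphM /= => /eqP -> /eqP ->; rewrite mulr0 addr0.
- by rewrite !unfold_in rmorphM mulf_eq0.
- apply/family_idealP => // t y; apply: pihomog_vanish => // t'.
  have /family_idealP f_eq0 : f \in family_ideal U0 V0 W0 dU dV dW i by [].
  rewrite -[RHS](f_eq0 char0 le_im (t' * t) y) -family_tensorZ.
  by apply: meval_eq => k; rewrite mxE.
have [k Tk] : exists k, tsum U0 V0 W0 0 k != 0 by apply/rV0Pn.
exists k; apply: contra_neqN Tk => /(family_idealP _ _ _ _ _ _ _ char0 le_im)/(_ 1 (fun=> 0)).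
rewrite mevalXU /family_tensor scale1r.
have eqF n (X0 : 'M[K]_(s, n)) (dX : 'I_m -> _) : family idfun X0 dX i (fun=> 0) = X0.
  rewrite /family map_mx_id // big1 ?addr0 // => l _; by rewrite scale0r.
by rewrite !eqF.
Qed.

(** Closing the last direction means setting a parameter to 0. *)
Lemma family_ideal_sub (K : fieldType) s a b c m
    (U0 : 'M[K]_(s, a)) (V0 : 'M[K]_(s, b)) (W0 : 'M[K]_(s, c))
    (dU : 'I_m -> _) (dV : 'I_m -> _) (dW : 'I_m -> _) i :
  [pchar K] =i pred0 -> (i < m)%N ->
  {subset family_ideal U0 V0 W0 dU dV dW i.+1 <= family_ideal U0 V0 W0 dU dV dW i}.
Proof.
move=> char0 lt_im f /(family_idealP _ _ _ _ _ _ _ char0 lt_im) f_eq0.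
apply/family_idealP => // [|t y]; first exact: ltnW.
rewrite -[RHS](f_eq0 t (fun l => if (l < i)%N then y l else 0)).
have eqF n (X0 : 'M[K]_(s, n)) (dX : 'I_m -> _) :
    family idfun X0 dX i y = family idfun X0 dX i.+1 (fun l => if (l < i)%N then y l else 0).
  rewrite /family; congr (_ + _); rewrite [in RHS](bigID (fun l : 'I_m => (l < i)%N)) /=.
  rewrite [X in _ = _ + X]big1 ?addr0 => [|l /andP [_ /negPf ->]]; last by rewrite scale0r.
  apply: eq_big => [l|l ->] //; case: (ltnP l i) => [/ltnW|]; rewrite ltnS ?andbT ?andbF //.
by rewrite /family_tensor !eqF.
Qed.

Lemma mderiv_tsum (K : fieldType) n s a b c l (U : 'M[{mpoly K[n]}]_(s, a))
    (V : 'M[{mpoly K[n]}]_(s, b)) (W : 'M[{mpoly K[n]}]_(s, c)) :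
  map_mx (mderiv l) (tsum U V W) =
    tangent U V W (map_mx (mderiv l) U) (map_mx (mderiv l) V) (map_mx (mderiv l) W).
Proof.
apply: eq_tensor => i j k; rewrite tangentE mxE tsumE raddf_sum.
by apply: eq_bigr => p _ /=; rewrite !mderivM !mxE; ring.
Qed.

(** The parameters of the tensor [tsum U0 V0 W0] itself: t = 1 and no displacement. *)
Definition family_origin (K : fieldType) i (l : 'I_i.+1) : K := (l == 0)%:R.

Lemma family_at_origin (K : fieldType) s a m (X0 : 'M[K]_(s, a)) (dX : 'I_m -> 'M[K]_(s, a)) i :
  (i <= m)%N ->
  map_mx (meval (@family_origin K i)) (family (@mpolyC i.+1 K) X0 dX i (@family_var K m i)) = X0.
Proof.
move=> le_im; apply/matrixP => p q; rewrite !mxE rmorphD /= mevalC summxE raddf_sum big1 ?addr0 //=.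
move=> l lt_li; rewrite !mxE mevalM mevalXU /family_origin.
by rewrite -val_eqE /= inordK // mul0r.
Qed.

Lemma mderiv_family (K : fieldType) s a m (X0 : 'M[K]_(s, a)) (dX : 'I_m -> 'M[K]_(s, a)) i
    (k : 'I_i.+1) : (i <= m)%N ->
  map_mx (mderiv k) (family (@mpolyC i.+1 K) X0 dX i (@family_var K m i)) =
    \sum_(l < m | l.+1 == k :> nat) map_mx (@mpolyC i.+1 K) (dX l).
Proof.
move=> le_im; apply/matrixP => p q; rewrite !mxE mderivD mderivC add0r !summxE raddf_sum.
rewrite (bigID (fun l : 'I_m => l.+1 == k :> nat)) /= [X in _ + X]big1 ?addr0 => [|l].
  apply: eq_big => [l|l /andP [lt_li /eqP eq_lk]].
    rewrite andb_idl // => /eqP eq_lk; have := ltn_ord k; by rewrite -eq_lk ltnS.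
  rewrite !mxE mderivM mderivC mulr0 addr0 /family_var mderivXU.
  by rewrite -val_eqE /= inordK ?eq_lk ?eqxx ?mul1r // -eq_lk ltnS.
case/andP=> lt_li neq_lk; rewrite !mxE mderivM mderivC mulr0 addr0 /family_var mderivXU.
by rewrite -val_eqE /= inordK // (negPf neq_lk) mul0r.
Qed.

(** The rows of the Jacobian at [family_origin]: the derivative in [t] comes
    first and is the tensor itself. *)
Definition direction (R : comNzRingType) s a b c m
    (U0 : 'M[R]_(s, a)) (V0 : 'M[R]_(s, b)) (W0 : 'M[R]_(s, c))
    (dU : 'I_m -> _) (dV : 'I_m -> _) (dW : 'I_m -> _)
    (k : 'I_m.+1) :=
  if unlift 0 k is Some l then tangent U0 V0 W0 (dU l) (dV l) (dW l) else tsum U0 V0 W0.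

Lemma tangent_direction (R : comNzRingType) s a b c m
    (U0 : 'M[R]_(s, a)) (V0 : 'M[R]_(s, b)) (W0 : 'M[R]_(s, c))
    (dU : 'I_m -> _) (dV : 'I_m -> _) (dW : 'I_m -> _) x :
  tangent U0 V0 W0 (x 0 *: U0 + \sum_l x (lift 0 l) *: dU l)
      (\sum_l x (lift 0 l) *: dV l) (\sum_l x (lift 0 l) *: dW l) =
    \sum_k x k *: direction U0 V0 W0 dU dV dW k.
Proof.
rewrite big_ord_recl /direction unlift_none; under [in RHS]eq_bigr do rewrite liftK.
apply: eq_tensor => i j k; rewrite tangentE 2!mxE tsumE summxE mulr_sumr.
under [X in _ = _ + X]eq_bigr do rewrite mxE tangentE mulr_sumr.
rewrite [X in _ = _ + X]exchange_big -big_split; apply: eq_bigr => p _ /=.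
rewrite 2!mxE !summxE !(mulr_suml, mulr_sumr, mulrDl) -!addrA; congr (_ + _); first by ring.
by rewrite -!big_split; apply: eq_bigr => l _ /=; rewrite !mxE; ring.
Qed.

Lemma map_tangent (R R' : comNzRingType) (phi : {rmorphism R -> R'}) s a b c
    (U : 'M[R]_(s, a)) (V : 'M[R]_(s, b)) (W : 'M[R]_(s, c)) dU dV dW :
  map_mx phi (tangent U V W dU dV dW) =
    tangent (map_mx phi U) (map_mx phi V) (map_mx phi W)
      (map_mx phi dU) (map_mx phi dV) (map_mx phi dW).
Proof. by rewrite /tangent !map_mxD !map_tsum. Qed.

Lemma jacobian_at_origin (K : fieldType) s a b c m
    (U0 : 'M[K]_(s, a)) (V0 : 'M[K]_(s, b)) (W0 : 'M[K]_(s, c))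
    (dU : 'I_m -> _) (dV : 'I_m -> _) (dW : 'I_m -> _) i
    (le_im : (i.+1 <= m.+1)%N) (k : 'I_i.+1) :
  map_mx (meval (@family_origin K i)) (map_mx (mderiv k) (generic_tensor U0 V0 W0 dU dV dW i)) =
    direction U0 V0 W0 dU dV dW (widen_ord le_im k).
Proof.
pose x (l : 'I_m.+1) : K := (l == widen_ord le_im k)%:R.
have <- : \sum_l x l *: direction U0 V0 W0 dU dV dW l = direction U0 V0 W0 dU dV dW (widen_ord le_im k).
  rewrite (bigD1 (widen_ord le_im k)) //= big1 => [|l /negPf neq_l]; last by rewrite /x neq_l scale0r.
  by rewrite /x eqxx scale1r addr0.
have dF n (X0 : 'M[K]_(s, n)) dX : map_mx (meval (@family_origin K i))
    (map_mx (mderiv k) (family (@mpolyC i.+1 K) X0 dX i (@family_var K m i))) =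
    \sum_l x (lift 0 l) *: dX l.
  rewrite mderiv_family // raddf_sum big_mkcond; apply: eq_bigr => l _ /=.
  rewrite /x -val_eqE /= /bump add1n; case: eqP => _; rewrite ?scale0r // scale1r.
  by apply/matrixP => p q; rewrite !mxE mevalC.
rewrite mderiv_tsum -tangent_direction.
have -> : map_mx (mderiv k) ('X_0 *: family (@mpolyC i.+1 K) U0 dU i (@family_var K m i)) =
    (k == 0)%:R *: family (@mpolyC i.+1 K) U0 dU i (@family_var K m i) +
    'X_0 *: map_mx (mderiv k) (family (@mpolyC i.+1 K) U0 dU i (@family_var K m i)).
  by apply/matrixP => p q; rewrite !mxE mderivM mderivXU eq_sym.
have ev0 : meval (@family_origin K i) 'X_0 = 1 by rewrite mevalXU /family_origin eqxx.
have evX (X : 'M[{mpoly K[i.+1]}]_(s, a)) :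
    map_mx (meval (@family_origin K i)) ('X_0 *: X) = map_mx (meval (@family_origin K i)) X.
  by rewrite map_mxZ /= ev0 scale1r.
have evD (X Y : 'M[{mpoly K[i.+1]}]_(s, a)) :
    map_mx (meval (@family_origin K i)) ((k == 0)%:R *: X + 'X_0 *: Y) =
    (k == 0)%:R *: map_mx (meval (@family_origin K i)) X + map_mx (meval (@family_origin K i)) Y.
  by rewrite map_mxD map_mxZ rmorph_nat evX.
by rewrite map_tangent evX evD !dF !family_at_origin // /x -!val_eqE /= eq_sym.
Qed.

(** The linear forms [z] are dual to the first i + 2 rows of the Jacobian.  On the
    bigger family they are independent, since their Jacobian there is the identity
    matrix; on the smaller one they satisfy a relation, for lack of variables. *)
Lemma family_ideal_proper (K : fieldType) s a b c m
    (U0 : 'M[K]_(s, a)) (V0 : 'M[K]_(s, b)) (W0 : 'M[K]_(s, c))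
    (dU : 'I_m -> _) (dV : 'I_m -> _) (dW : 'I_m -> _) i :
  [pchar K] =i pred0 -> (i < m)%N ->
  (forall x, \sum_k x k *: direction U0 V0 W0 dU dV dW k = 0 -> forall k, x k = 0) ->
  exists2 f, f \in family_ideal U0 V0 W0 dU dV dW i
           & f \notin family_ideal U0 V0 W0 dU dV dW i.+1.
Proof.
move=> char0 lt_im free.
pose M := \matrix_k direction U0 V0 W0 dU dV dW k.
have M_free : row_free M.
  apply: inj_row_free => x; rewrite mulmx_sum_row => xM; apply/rowP => k; rewrite mxE.
  by apply: free; rewrite -[RHS]xM; apply: eq_bigr => l _; rewrite rowK.
have le_im : (i.+2 <= m.+1)%N by [].
(* The columns of a right inverse of the Jacobian. *)
pose N j k := pinvmx M k (widen_ord le_im j).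
pose z (j : 'I_i.+2) : {mpoly K[a * (b * c)]} := \sum_k N j k *: 'X_k.
have zE i' j : mmap (@mpolyC i'.+1 K) (generic_tensor U0 V0 W0 dU dV dW i' 0) (z j) =
    \sum_k N j k *: generic_tensor U0 V0 W0 dU dV dW i' 0 k.
  by rewrite raddf_sum; apply: eq_bigr => k _; rewrite /= mmapZ mmapX mmap1U mul_mpolyC.
have [G G_neq0 G_eq0] := alg_dependent
  (fun j => mmap (@mpolyC i.+1 K) (generic_tensor U0 V0 W0 dU dV dW i 0) (z j)) (ltnSn i.+1).
exists (mmap (@mpolyC _ K) z G).
  rewrite unfold_in rmorph_mmap; apply/eqP; rewrite -[RHS]G_eq0.
  by apply: eq_mmap => // e /=; rewrite mmapC.
rewrite unfold_in rmorph_mmap; apply: contra_neqN G_neq0 => /eqP.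
pose Z j := mmap (@mpolyC i.+2 K) (generic_tensor U0 V0 W0 dU dV dW i.+1 0) (z j).
have -> : mmap (mmap (@mpolyC i.+2 K) (generic_tensor U0 V0 W0 dU dV dW i.+1 0) \o @mpolyC _ K)
    (mmap (@mpolyC i.+2 K) (generic_tensor U0 V0 W0 dU dV dW i.+1 0) \o z) G =
    mmap (@mpolyC i.+2 K) Z G.
  by apply: eq_mmap => // e /=; rewrite mmapC.
move=> GZ; pose g (l : 'I_0) : {mpoly K[i.+2]} := 0.
pose del (k l : 'I_i.+2) : {mpoly K[i.+2]} := (k == l)%:R.
have delE k p : derivation (del k) p = p^`M(k).
  rewrite /derivation (bigD1 k) //= big1 => [|l neq_lk]; last first.
    by rewrite /del eq_sym (negPf neq_lk) mul0r.
  by rewrite /del eqxx mul1r addr0.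
apply: (@derivation_indep K i.+2 0 i.+2 del g Z (@family_origin K i.+1) (fun=> 1)) => //.
- by move=> H; rewrite [H]mpoly_nullary mmapC => /eqP; rewrite mpolyC_eq0 => /eqP ->.
- by move=> k [].
- move=> k j; rewrite delE /Z zE (raddf_sum (mderiv k)) raddf_sum /=.
  have <- : (M *m pinvmx M) (widen_ord le_im k) (widen_ord le_im j) = 1 *+ (k == j).
    by rewrite mulmxVp // mxE -val_eqE.
  rewrite mxE; apply: eq_bigr => l _; rewrite mderivZ mevalZ mulrC; congr (_ * _).
  by have := jacobian_at_origin U0 V0 W0 dU dV dW le_im k; move/rowP/(_ l); rewrite !mxE.
- by move=> k; rewrite oner_eq0.
rewrite -[RHS]GZ; apply: eq_mmap => // j; case: split_ordP => [[]//|j' ->].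
by congr Z; apply: val_inj.
Qed.

(** An instance of Terracini's lemma: a rank of the differential bounds the
    dimension from below. *)
Lemma secant_variety_chain (K : fieldType) s a b c m
    (U0 : 'M[K]_(s.+1, a.+1)) (V0 : 'M[K]_(s.+1, b.+1)) (W0 : 'M[K]_(s.+1, c.+1))
    (dU : 'I_m -> _) (dV : 'I_m -> _) (dW : 'I_m -> _) :
  [pchar K] =i pred0 ->
  (forall x, \sum_k x k *: direction U0 V0 W0 dU dV dW k = 0 -> forall k, x k = 0) ->
  exists p, proj_chain (secant_variety s.+1 (@segre K a b c)) m p.
Proof.
move=> char0 free; exists (fun i => family_ideal U0 V0 W0 dU dV dW (m - i)).
have T0_neq0 : tsum U0 V0 W0 != 0.
  apply/eqP => T0; suff /(_ 0)/eqP : forall k : 'I_m.+1, (k == 0)%:R = 0 :> K.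
    by rewrite eqxx oner_eq0.
  apply: (free (fun k => (k == 0)%:R)).
  rewrite big_ord_recl big1 => [|l _]; last by rewrite eq_sym (negPf (neq_lift _ _)) scale0r.
  by rewrite eqxx scale1r /direction unlift_none T0 addr0.
split=> [i _|f f_homog f_van|i lt_im].
- by apply: family_prime; rewrite ?leq_subr.
- rewrite subn0; apply/family_idealP => // t y.
  exact: (vanishes_secant_variety _ f_homog).1.
have -> : (m - i = (m - i.+1).+1)%N by rewrite -subSn.
have lt_m : (m - i.+1 < m)%N by lia.
by split; [apply: family_ideal_sub | apply: family_ideal_proper].
Qed.

(** * A five-tuple of points at which the differential has maximal rank *)

(** The equations say that the tangent vector is zero at position (k, i, j).  For
    i <> j they put a combination of u_i and u_j plus (x_i + y_j) u_4 + dU_4 equal to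
    zero, where x = dV_4 and y = dW_4; eliminating the terms in u_i and u_j leaves
    conditions on x, y and dU_4 alone, which are solved first. *)
Lemma base_equations_trivial (K : fieldType) (dU dV dW : nat -> nat -> K) t
    (u := fun p k => if (p < 3)%N then (p == k)%:R else 1 : K) :
  [pchar K] =i pred0 ->
  (forall i j k, (i < 4)%N -> (j < 4)%N -> (k < 3)%N ->
     (i == j)%:R * dU i k + u j k * dV j i + u i k * dW i j +
       (dU 4 k + k.+1%:R * (dV 4 i + dW 4 j)) = 0) ->
  (forall i, (i < 4)%N -> dV i i = 0 /\ dW i i = 0) -> dV 4 3 = 0 -> dW 4 3 = 0 ->
  dU 4 1 = t * 2 -> dU 4 2 = t * 3 ->
  t = 0 /\ forall p q, (p < 5)%N ->
    [/\ (q < 3)%N -> dU p q = 0, (q < 4)%N -> dV p q = 0 & (q < 4)%N -> dW p q = 0].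
Proof.
move=> char0 E diag x3 y3 U1 U2.
have natr_neq0 n : n.+1%:R != 0 :> K by have /pcharf0P -> := char0.
(* Solves for z from two equations e = 0 and f = 0. *)
have comb (a b z e f : K) : e = 0 -> f = 0 -> z = a * e + b * f -> z = 0.
  by move=> -> -> ->; rewrite !mulr0 addr0.
have n2 : 2 != 0 :> K := natr_neq0 1. have n3 : 3 != 0 :> K := natr_neq0 2.
have x0 : dV 4 0 + t = 0.
  apply: (comb (-1) 1 _ _ _ (E 0 3 1 _ _ _) (E 0 3 2 _ _ _)) => //.
  by rewrite /u /= U1 U2 y3; ring.
have y1 : dW 4 1 = 0.
  apply: (comb (1 / 3) (-1) _ _ _ (E 0 1 2 _ _ _) x0) => //.
  by rewrite /u /= U2; field.
have y2 : dW 4 2 = 0.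
  apply: (comb (1 / 2) (-1) _ _ _ (E 0 2 1 _ _ _) x0) => //.
  by rewrite /u /= U1; field.
have q3 : dU 4 0 - 3 * t = 0.
  apply: (comb 1 (-1) _ _ _ (E 3 1 0 _ _ _) (E 3 1 2 _ _ _)) => //.
  by rewrite /u /= U2 x3 y1; ring.
have q2 : dU 4 0 - 2 * t = 0.
  apply: (comb 1 (-1) _ _ _ (E 3 2 0 _ _ _) (E 3 2 1 _ _ _)) => //.
  by rewrite /u /= U1 x3 y2; ring.
have t0 : t = 0 by apply: (comb (-1) 1 _ _ _ q3 q2); ring.
have q0 : dU 4 0 = 0 by apply: (comb (-2) 3 _ _ _ q3 q2); ring.
rewrite t0 mul0r in U1; rewrite t0 mul0r in U2; rewrite t0 addr0 in x0.
have y0 : dW 4 0 = 0.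
  apply: (comb (-1) 1 _ _ _ (E 3 0 1 _ _ _) (E 3 0 2 _ _ _)) => //.
  by rewrite /u /= U1 U2 x3; ring.
have x1 : dV 4 1 = 0.
  apply: (comb (- 1 / 2) (1 / 2) _ _ _ (E 1 3 0 _ _ _) (E 1 3 2 _ _ _)) => //.
  by rewrite /u /= U2 q0 y3; field.
have x2 : dV 4 2 = 0.
  apply: (comb (- 1) 1 _ _ _ (E 2 3 0 _ _ _) (E 2 3 1 _ _ _)) => //.
  by rewrite /u /= U1 q0 y3; ring.
have dU4 k : (k < 3)%N -> dU 4 k = 0 by case: k => [|[|[|]]].
have dV4 k : (k < 4)%N -> dV 4 k = 0 by case: k => [|[|[|[|]]]].
have dW4 k : (k < 4)%N -> dW 4 k = 0 by case: k => [|[|[|[|]]]].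
have {}E i j k : (i < 4)%N -> (j < 4)%N -> (k < 3)%N ->
    (i == j)%:R * dU i k + u j k * dV j i + u i k * dW i j = 0.
  move=> lti ltj ltk; have := E i j k lti ltj ltk.
  by rewrite (dU4 k) // (dV4 i) // (dW4 j) // add0r addr0 mulr0 addr0.
have offdiag i j : (i < 4)%N -> (j < 4)%N -> dV j i = 0 /\ dW i j = 0.
  move=> lti ltj; have [<-|neq_ij] := eqVneq i j; first exact: diag.
  have {}E k : (k < 3)%N -> u j k * dV j i + u i k * dW i j = 0.
    by move=> ltk; have := E i j k lti ltj ltk; rewrite (negPf neq_ij) mul0r add0r.
  have [lt_i3|le_3i] := ltnP i 3.
    pose k := if (j < 3)%N then j else nat_of_bool (i == 0)%N.
    have uj : u j k = 1 by rewrite /u /k; case: (j < 3)%N; rewrite ?eqxx.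
    have ui : u i k = 0.
      by rewrite /u /k lt_i3; case: (j < 3)%N; [rewrite (negPf neq_ij) | case: (i) => [|[]]].
    have V0 : dV j i = 0.
      have := E k; rewrite uj ui mul1r mul0r addr0; apply.
      by rewrite /k; case: ifP => // _; case: eqP.
    by have := E i lt_i3; rewrite V0 mulr0 add0r {1}/u lt_i3 eqxx mul1r.
  have i3 : i = 3 by lia. have lt_j3 : (j < 3)%N by lia.
  have ui k : u i k = 1 by rewrite /u i3.
  have W0 : dW i j = 0.
    have := E (nat_of_bool (j == 0)%N); rewrite ui mul1r {1}/u lt_j3.
    by case: (j) => [|[|n]] /=; rewrite mul0r add0r; apply.
  by have := E j lt_j3; rewrite W0 mulr0 addr0 {1}/u lt_j3 eqxx mul1r.
have dU0 i k : (i < 4)%N -> (k < 3)%N -> dU i k = 0.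
  move=> lti ltk; have := E i i k lti lti ltk.
  by have [-> ->] := diag i lti; rewrite eqxx mul1r !mulr0 !addr0.
split=> // p q; rewrite ltnS leq_eqVlt => /orP [/eqP ->|ltp]; first by split; auto.
split=> ltq; [exact: dU0 | exact: (offdiag _ _ ltq ltp).1 | exact: (offdiag _ _ ltp ltq).2].
Qed.

Lemma base_UE (R : comNzRingType) (p : 'I_5) k :
  base_U R p k = if (p < 3)%N then (p == k :> nat)%:R else k.+1%:R ^+ (p - 3).
Proof.
rewrite /base_U; case: (split_ordP (p : 'I_(3 + 2))) => r ->.
  by rewrite col_mxEu mxE /= ?ltn_ord.
by rewrite col_mxEd mxE /= addKn.
Qed.

Lemma base_VE (R : comNzRingType) (p : 'I_5) k :
  base_V R p k = if (p < 4)%N then (p == k :> nat)%:R else 1.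
Proof.
rewrite /base_V; case: (split_ordP (p : 'I_(4 + 1))) => r ->.
  by rewrite col_mxEu mxE /= ?ltn_ord.
by rewrite col_mxEd mxE.
Qed.

Lemma base_tangent_injective (K : fieldType) (dU : 'M[K]_(5, 3)) (dV dW : 'M[K]_(5, 4)) t :
  [pchar K] =i pred0 ->
  tangent (s := 5) (base_U K) (base_V K) (base_V K) dU dV dW = 0 ->
  (forall p : 'I_5, dV p (inord (minn p 3)) = 0 /\ dW p (inord (minn p 3)) = 0) ->
  dU ord_max (inord 1) = t * 2 -> dU ord_max (inord 2) = t * 3 ->
  [/\ t = 0, dU = 0, dV = 0 & dW = 0].
Proof.
move=> char0 T0 diag U1 U2.
pose nU p q := dU (inord p) (inord q); pose nV p q := dV (inord p) (inord q).
pose nW p q := dW (inord p) (inord q).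
have max4 : @ord_max 4 = inord 4 by apply: val_inj; rewrite /= inordK.
have sum_delta (F : nat -> K) i : (i < 4)%N -> \sum_(p < 4) F p * (p == i :> nat)%:R = F i.
  move=> lti; rewrite (bigD1 (Ordinal lti)) //= eqxx mulr1 big1 ?addr0 // => p neq_pi.
  by rewrite -val_eqE /= in neq_pi; rewrite (negPf neq_pi) mulr0.
have wE (p : 'I_4) : widen_ord (leqnSn 4) p = inord p :> 'I_5.
  by apply: val_inj; rewrite /= inordK // ltnW // ltnS ltn_ord.
pose u k p : K := if (p < 3)%N then (p == k)%:R else k.+1%:R ^+ (p - 3).
have [] := @base_equations_trivial K nU nV nW t char0.
- move=> i j k lti ltj ltk; have /rowP/(_ (tidx (inord k) (inord i) (inord j))) := T0.
  rewrite tangentE mxE big_ord_recr /= !base_UE !base_VE /= => E.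
  rewrite -[RHS]E; congr (_ + _); last first.
    by rewrite /nU /nV /nW max4 inordK // expr1; ring.
  under eq_bigr => p _ do rewrite !base_VE base_UE /= ltn_ord !inordK // wE -/(u k p)
    -/(nU p k) -/(nV p i) -/(nW p j) [u k p * (p == i :> nat)%:R * _]mulrAC.
  rewrite !big_split /= (sum_delta (fun p => nU p k * (p == i)%:R)) //.
  rewrite (sum_delta (fun p => u k p * nV p i)) // (sum_delta (fun p => u k p * nW p j)) //.
  have uE p : (p < 4)%N -> u k p = if (p < 3)%N then (p == k)%:R else 1.
    by rewrite /u ltnS -subn_eq0 => /eqP ->; rewrite expr0.
  rewrite !uE //; congr (_ + _ + _).
  by have [->|neq_ij] := eqVneq i j; rewrite ?eqxx ?mulr1 ?mul1r // mulr0 mul0r.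
- move=> i lti; have := diag (inord i); rewrite (inordK (leqW lti)).
  by have /minn_idPl -> : (i <= 3)%N by [].
- by have [] := diag (inord 4); rewrite (@inordK 4 4).
- by have [] := diag (inord 4); rewrite (@inordK 4 4).
- by rewrite /nU -max4.
- by rewrite /nU -max4.
move=> t0 all0; split=> //; apply/matrixP => p q; rewrite mxE.
- by have [+ _ _] := all0 p q (ltn_ord p); rewrite /nU !inord_val; apply.
- by have [_ + _] := all0 p q (ltn_ord p); rewrite /nV !inord_val; apply.
by have [_ _ +] := all0 p q (ltn_ord p); rewrite /nW !inord_val; apply.
Qed.

(** The 43 coordinates that are varied: U_p for p < 4, one coordinate of U_4, and
    three coordinates of each V_p and W_p.  Left out are the directions that the
    scalings of the factors make redundant and, besides, two coordinates of U_4: one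
    for the scaling by [t], one for the one-parameter family of decompositions of a
    general tensor. *)
Definition slot : finType := ('I_4 * 'I_3 + unit + 'I_5 * 'I_3 + 'I_5 * 'I_3)%type.

Lemma card_slot : #|slot| = 43.
Proof. by rewrite !card_sum !card_prod !card_ord card_unit. Qed.

(** The coordinate of V_p and W_p that is kept fixed; it is nonzero at the base
    point. *)
Definition pivot (p : 'I_5) : 'I_4 := inord (minn p 3).

Definition slot_U (R : comNzRingType) (x : slot) : 'M[R]_(5, 3) :=
  match x with
  | inl (inl (inl (p, k))) => delta_mx (widen_ord (leqnSn 4) p) k
  | inl (inl (inr _)) => delta_mx ord_max 0
  | _ => 0
  end.
Definition slot_V (R : comNzRingType) (x : slot) : 'M[R]_(5, 4) :=
  if x is inl (inr (p, j)) then delta_mx p (lift (pivot p) j) else 0.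
Definition slot_W (R : comNzRingType) (x : slot) : 'M[R]_(5, 4) :=
  if x is inr (p, j) then delta_mx p (lift (pivot p) j) else 0.

Lemma sum_slot (K : fieldType) (y : 'I_#|slot| -> K) m n (X : slot -> 'M[K]_(m, n)) p q x0 :
  (forall x, X x p q = (x == x0)%:R) ->
  (\sum_l y l *: X (enum_val l)) p q = y (enum_rank x0).
Proof.
move=> XE; rewrite summxE (bigD1 (enum_rank x0)) //= big1 => [|l neq_l].
  by rewrite !mxE XE enum_rankK eqxx mulr1 addr0.
rewrite !mxE XE; case: eqP => [eq_l|_]; last by rewrite mulr0.
by rewrite -eq_l enum_valK eqxx in neq_l.
Qed.

Lemma sum_slot0 (K : fieldType) (y : 'I_#|slot| -> K) m n (X : slot -> 'M[K]_(m, n)) p q :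
  (forall x, X x p q = 0) -> (\sum_l y l *: X (enum_val l)) p q = 0.
Proof. by move=> XE; rewrite summxE big1 // => l _; rewrite mxE XE mulr0. Qed.

Lemma slot_directions_free (K : fieldType) (x : 'I_#|slot|.+1 -> K) :
  [pchar K] =i pred0 ->
  \sum_k x k *: direction (s := 5) (base_U K) (base_V K) (base_V K)
    (fun l => slot_U K (enum_val l)) (fun l => slot_V K (enum_val l))
    (fun l => slot_W K (enum_val l)) k = 0 ->
  forall k, x k = 0.
Proof.
move=> char0; rewrite -tangent_direction.
set dU := \sum_l _ *: slot_U K _; set dV := \sum_l _; set dW := \sum_l _.
move/(base_tangent_injective char0) => free.
have {}free : [/\ x 0 = 0, x 0 *: base_U K + dU = 0, dV = 0 & dW = 0].
  apply: free => [p||].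
  - rewrite -/(pivot p); split; apply: sum_slot0 => [[[[[p' k]|[]]|[p' j]]|[p' j]]] /=;
      rewrite !mxE //; case: eqP => // <-; by rewrite (negPf (neq_lift _ _)).
  - rewrite mxE [X in _ + X]sum_slot0 ?addr0 => [|[[[[p' k]|[]]|[p' j]]|[p' j]] /=].
    + by rewrite mxE base_UE /= inordK.
    + by rewrite !mxE -!val_eqE /= gtn_eqF.
    + by rewrite !mxE -!val_eqE /= inordK.
    + by rewrite mxE.
    + by rewrite mxE.
  - rewrite mxE [X in _ + X]sum_slot0 ?addr0 => [|[[[[p' k]|[]]|[p' j]]|[p' j]] /=].
    + by rewrite mxE base_UE /= inordK.
    + by rewrite !mxE -!val_eqE /= gtn_eqF.
    + by rewrite !mxE -!val_eqE /= inordK.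
    + by rewrite mxE.
    + by rewrite mxE.
have [x0 U0 V0 W0] := free; rewrite x0 scale0r add0r in U0.
move=> k; case: (unliftP 0 k) => [l ->|-> //].
rewrite -(enum_valK l).
case: (enum_val l) => [[[[p q]|[]]|[p j]]|[p j]].
- have /matrixP/(_ (widen_ord (leqnSn 4) p) q) := U0.
  rewrite (sum_slot _ (x0 := inl (inl (inl (p, q))))) ?mxE // => -[[[[p' q']|[]]|[p' j']]|[p' j']] /=.
  + rewrite mxE !(inj_eq inl_inj) xpair_eqE -!val_eqE /= eq_sym.
    by rewrite [_ == q' :> nat]eq_sym.
  + by rewrite mxE -val_eqE /= ltn_eqF.
  + by rewrite mxE.
  + by rewrite mxE.
- have /matrixP/(_ ord_max 0) := U0.
  rewrite (sum_slot _ (x0 := inl (inl (inr tt)))) ?mxE // => -[[[[p' q']|[]]|[p' j']]|[p' j']] /=.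
  + by rewrite mxE -val_eqE /= gtn_eqF.
  + by rewrite mxE !eqxx.
  + by rewrite mxE.
  + by rewrite mxE.
- have /matrixP/(_ p (lift (pivot p) j)) := V0.
  rewrite (sum_slot _ (x0 := inl (inr (p, j)))) ?mxE // => -[[[[p' q']|[]]|[p' j']]|[p' j']] /=;
    rewrite ?mxE // (inj_eq inl_inj) (inj_eq inr_inj) xpair_eqE eq_sym.
  by case: eqP => // ->; rewrite (inj_eq lift_inj) eq_sym.
have /matrixP/(_ p (lift (pivot p) j)) := W0.
rewrite (sum_slot _ (x0 := inr (p, j))) ?mxE // => -[[[[p' q']|[]]|[p' j']]|[p' j']] /=;
  rewrite ?mxE // (inj_eq inr_inj) xpair_eqE eq_sym.
by case: eqP => // ->; rewrite (inj_eq lift_inj) eq_sym.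
Qed.

Theorem proposition4p10 (K : fieldType) (charK0 : [pchar K] =i pred0) :
  proj_dim (secant_variety 5 (@segre K 2 3 3)) 43.
Proof.
split=> [|r p]; last exact: proj_dim_le.
have := secant_variety_chain charK0 (@slot_directions_free K ^~ charK0).
by rewrite card_slot.
Qed.
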